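(* Let $G$ be a finitely presented group. Let $\mathcal{S}_G$ be the space of $\mathbb{Z}_2$-linear combinations of equivalence classes of $G$-graphs having no vertex labeled by the unit element of $G$, modulo the second and the third Reidemeister moves (between such $G$-graphs). For a $G$-graph $K$ put $$[K]_G=\sum_{s}K_s\in\mathcal{S}_G,$$ where the sum is over all ways $s$ of smoothing all vertices of $K$ labeled by the unit element of $G$ such that the resulting $G$-graph $K_s$ has exactly one component. Then the map $[\cdot]_G$ is an invariant of $G$-knots, i.e. if $G$-graphs $K$ and $K'$ represent the same $G$-knot, then $[K]_G=[K']_G$ in $\mathcal{S}_G$.
   Context: Framed 4-graphs. A 4-graph is a finite 4-valent graph (loops and multiple edges allowed), possibly together with finitely many circular components (circles without vertices, disjoint from the rest). It is framed if at every vertex the four half-edges are split into two pairs; half-edges in the same pair are called opposite, half-edges at the vertex which are not opposite are called adjacent. A unicursal component is an equivalence class of edges under the relation generated by being opposite at some vertex. The number of components is the number of circular components plus the number of unicursal components. A source-sink structure is an orientation of all edges such that at every vertex the two half-edges of one opposite pair are emanating and the two half-edges of the other opposite pair are incoming (circular components are just assumed oriented). $G$-graphs. A $G$-graph is a framed 4-graph with a chosen source-sink structure and a map (labeling) from its set of vertices to $G$. Graphs are considered up to isomorphism preserving all the structure. Reidemeister moves on $G$-graphs (everything outside the described fragment, including the edge orientations, is unchanged). R1: if a vertex $X$ labeled $1$ carries a loop whose two half-edges are adjacent at $X$, delete $X$ and the loop and join the other two half-edges at $X$ into one edge; or the inverse operation. R2: if distinct vertices $v,w$ with mutually inverse labels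 are connected by two edges $e_1,e_2$ that are non-opposite at $v$ and at $w$, delete $v,w,e_1,e_2$, and for $i=1,2$ join the half-edge opposite to $e_i$ at $v$ with the half-edge opposite to $e_i$ at $w$; or the inverse operation. R3: suppose distinct vertices $A,B,C$ labeled $a,b,c$ are connected by edges $A\to B$, $B\to C$, $C\to A$ (oriented by the source-sink structure), any two of them sharing a vertex being non-opposite there, and $a\cdot b\cdot c=1$. This fragment consists of three strands: strand 1 passes through $A$ then $B$, strand 2 through $B$ then $C$, strand 3 through $C$ then $A$, each entering and leaving through the outer half-edges opposite to the corresponding triangle edge. Replace $A,B,C$ by vertices $A',B',C'$ (crossings of the same pairs of strands as $A,B,C$) labeled $a^{-1},b^{-1},c^{-1}$, with the order of the two vertices on each strand reversed (outer ends of the strands unchanged; two half-edges at a new vertex are opposite if they lie on the same strand; the triangle edges receive the orientation making a source-sink structure). A $G$-free link is an equivalence class of $G$-graphs under R1, R2, R3; a $G$-knot is a one-component $G$-free link. Smoothing. A smoothing of a framed 4-graph at a vertex deletes this vertex and joins its four half-edges into two edges in one of the two possible ways in which each half-edge is joined to a half-edge not opposite to it. A smoothing of a $G$-graph inherits a source-sink structure, and the remaining vertices keep their labels; it may create new circular components, which count as components. *)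

(* Defs.v *)
From Stdlib Require Import Relation_Operators.
From HB Require Import structures.
From mathcomp Require Import all_boot all_algebra perm.
From mathcomp Require Import zify boolp freeg.

Set Implicit Arguments.
Unset Strict Implicit.
Unset Printing Implicit Defensive.

(* The letter (i, false) is the i-th generator and (i, true) is its inverse. *)
Definition word (n : nat) : Type := seq ('I_n * bool).

Definition word_val (G : groupType) (n : nat) (gen : 'I_n -> G) (w : word n) : G :=
  (\prod_(x <- w) (if x.2 then (gen x.1)^-1 else gen x.1))%g.

Variant word_step (n : nat) (rels : seq (word n)) : word n -> word n -> Prop :=
| WordCancel u x v :
    word_step rels (u ++ [:: x; (x.1, ~~ x.2)] ++ v) (u ++ v)
| WordRelator u r v : r \in rels -> word_step rels (u ++ r ++ v) (u ++ v).

Definition finitely_presented (G : groupType) : Prop :=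
  exists (n : nat) (rels : seq (word n)) (gen : 'I_n -> G),
    (forall x : G, exists w : word n, word_val gen w = x)
    /\ (forall w w' : word n, word_val gen w = word_val gen w' <->
          clos_refl_sym_trans (word n) (word_step rels) w w').

(* Data of a G-graph with vertices V and half-edges H.  An edge is an orbit
   {h, edge h}, an opposite pair is an orbit {h, opp h}, and [out h] says that h
   emanates from its vertex, so that the edge of h is oriented from h to
   [edge h] when [out h].  A circular component carries no further structure,
   and the two orientations of a circle are isomorphic, so these components are
   only counted. *)
Record graph_data (G : Type) (V H : finType) := GraphData {
  vtx : H -> V;
  edge : H -> H;
  opp : H -> H;
  out : pred H;
  label : V -> G;
  circles : nat
}.

Section GraphData.
Variables (G : groupType) (V H : finType).
Implicit Types (K : graph_data G V H) (h k : H).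

Definition framed_4graph K : Prop :=
  [/\ involutive (edge K), (forall h, edge K h != h),
      forall v, #|[set h | vtx K h == v]| = 4,
      involutive (opp K)
    & forall h, opp K h != h /\ vtx K (opp K h) = vtx K h].

Definition source_sink K : Prop :=
  (forall h, out K (edge K h) = ~~ out K h)
  /\ (forall h k, vtx K h = vtx K k ->
        (out K h == out K k) = (k == h) || (k == opp K h)).

(* Unicursal components are computed on half-edges instead of edges. *)
Definition ncomp K : nat :=
  circles K + n_comp (fun h k => (k == edge K h) || (k == opp K h)) H.

Definition adjacent K h k : bool :=
  [&& vtx K h == vtx K k, k != h & k != opp K h].

End GraphData.

Definition iso (G : groupType) (V H V' H' : finType)
    (K : graph_data G V H) (K' : graph_data G V' H') : Prop :=
  exists (fv : V -> V') (fh : H -> H'), bijective fv /\ bijective fh /\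
    [/\ forall h, vtx K' (fh h) = fv (vtx K h),
        forall h, edge K' (fh h) = fh (edge K h)
      & forall h, opp K' (fh h) = fh (opp K h)] /\
    [/\ forall h, out K' (fh h) = out K h,
        forall v, label K' (fv v) = label K v
      & circles K' = circles K].

Section Splice.
Variables (G : groupType) (V H : finType).
Variables (K : graph_data G V H) (D : {set V}) (j : H -> H).

(* Deletion of the vertices in D.  The involution j fixes the half-edges at the
   remaining vertices; a half-edge h at a deleted vertex is joined to j h if
   j h != h, and is deleted together with its edge if j h = h.  The new edge
   starting at a remaining half-edge h is followed through edge, j, edge, j, ...
   until it reaches a remaining half-edge.  Joined half-edges from which no
   remaining half-edge can be reached form new circular components. *)

Definition splice_exit (h : H) : H :=
  let s := traject (edge K \o j) (edge K h) #|H| in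
  nth h s (find (fun k => vtx K k \notin D) s).

Definition splice_circles : nat :=
  let r := fun h k => (k == edge K h) || (k == j h) in
  n_comp r [pred h | [forall k, connect r h k ==>
                        (vtx K k \in D) && (j k != k)]].

Let V' : finType := {v : V | v \notin D}.
Let H' : finType := {h : H | vtx K h \notin D}.

Definition splice : graph_data G V' H' := {|
  vtx := fun h : H' => Sub (vtx K (val h)) (valP h);
  edge := fun h => insubd h (splice_exit (val h));
  opp := fun h => insubd h (opp K (val h));
  out := fun h => out K (val h);
  label := fun v => label K (val v);
  circles := circles K + splice_circles
|}.

End Splice.

Section Moves.
Variables (G : groupType) (V H : finType) (K : graph_data G V H).

(* l and edge l are the two half-edges of the loop. *)
Definition r1_fragment (l : H) : bool :=
  adjacent K l (edge K l) && (label K (vtx K l) == 1%g).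

Definition r1_result (l : H) :=
  splice K [set vtx K l] (tperm (opp K l) (opp K (edge K l))).

(* l and m are the half-edges of e_1 and e_2 at v. *)
Definition r2_fragment (l m : H) : bool :=
  [&& vtx K l != vtx K (edge K l), adjacent K l m,
      adjacent K (edge K l) (edge K m)
    & label K (vtx K (edge K l)) == (label K (vtx K l))^-1%g].

Definition r2_result (l m : H) :=
  splice K [set vtx K l; vtx K (edge K l)]
    (tperm (opp K l) (opp K (edge K l)) \o tperm (opp K m) (opp K (edge K m))).

(* a, b, c are the initial half-edges, at A, B, C, of the edges A -> B, B -> C,
   C -> A. *)
Definition r3_fragment (a b c : H) : bool :=
  [&& [&& out K a, out K b & out K c],
      [&& vtx K a != vtx K b, vtx K b != vtx K c & vtx K c != vtx K a],
      [&& adjacent K (edge K a) b, adjacent K (edge K b) c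
        & adjacent K (edge K c) a]
    & (label K (vtx K a) * label K (vtx K b) * label K (vtx K c) == 1)%g].

(* On each strand, say the one through a and edge a, the outer half-edges opp a
   and opp (edge a) exchange their positions, keeping their edges and
   orientations, while a and edge a stay at their vertices; this reverses the
   order of the two vertices on the strand.  The source-sink condition at the new
   vertices then forces the reversal of the triangle edges.  The vertices
   A', B', C' are named A, B, C. *)
Definition r3_swap (a b c : H) : H -> H :=
  tperm (opp K a) (opp K (edge K a))
    \o tperm (opp K b) (opp K (edge K b))
    \o tperm (opp K c) (opp K (edge K c)).

Definition r3_result (a b c : H) : graph_data G V H := {|
  vtx := vtx K \o r3_swap a b c;
  edge := edge K;
  opp := r3_swap a b c \o opp K \o r3_swap a b c;
  out := fun h => out K h
           (+) (h \in [:: a; edge K a; b; edge K b; c; edge K c]);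
  label := fun v => if v \in [:: vtx K a; vtx K b; vtx K c]
                    then (label K v)^-1%g else label K v;
  circles := circles K
|}.

End Moves.

(* Finite carriers are normalised to ordinals, so that G-graphs form a type in
   the universe of G. *)
Record ggraph (G : groupType) := GGraph {
  nvert : nat;
  nhalf : nat;
  gdata :> graph_data G 'I_nvert 'I_nhalf;
  gframed : framed_4graph gdata;
  gsource_sink : source_sink gdata
}.

Definition move1 (G : groupType) (K L : ggraph G) : Prop :=
  exists l, r1_fragment K l /\ iso (r1_result K l) L.

Definition move2 (G : groupType) (K L : ggraph G) : Prop :=
  exists l m, r2_fragment K l m /\ iso (r2_result K l m) L.

Definition move3 (G : groupType) (K L : ggraph G) : Prop :=
  exists a b c, r3_fragment K a b c /\ iso (r3_result K a b c) L.

Definition free_link_equiv (G : groupType) : ggraph G -> ggraph G -> Prop :=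
  clos_refl_sym_trans (ggraph G)
    (fun K L => [\/ iso K L, move1 K L, move2 K L | move3 K L]).

Definition represent_same_knot (G : groupType) (K L : ggraph G) : Prop :=
  [/\ ncomp K = 1, ncomp L = 1 & free_link_equiv K L].

Definition nonunit (G : groupType) (K : ggraph G) : Prop :=
  forall v, label K v <> 1%g.

Definition nonunit_ggraph (G : groupType) : Type := {K : ggraph G | nonunit K}.

Definition nonunit_equiv (G : groupType) :
    nonunit_ggraph G -> nonunit_ggraph G -> Prop :=
  clos_refl_sym_trans (nonunit_ggraph G)
    (fun K L => [\/ iso (sval K) (sval L), move2 (sval K) (sval L)
                  | move3 (sval K) (sval L)]).

Definition nonunit_rel (G : groupType) : rel {classic nonunit_ggraph G} :=
  fun K L => `[< nonunit_equiv K L >].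

Lemma nonunit_rel_refl (G : groupType) : reflexive (@nonunit_rel G).
Proof. by move=> K; apply/asboolP; apply: rst_refl. Qed.

Lemma nonunit_rel_sym (G : groupType) : symmetric (@nonunit_rel G).
Proof. by move=> K L; apply/asboolP/asboolP; apply: rst_sym. Qed.

Lemma nonunit_rel_trans (G : groupType) : transitive (@nonunit_rel G).
Proof.
by move=> L K M /asboolP KL /asboolP LM; apply/asboolP; apply: rst_trans KL LM.
Qed.

Canonical nonunit_equiv_rel (G : groupType) :=
  EquivRel (@nonunit_rel G) (@nonunit_rel_refl G) (@nonunit_rel_sym G)
    (@nonunit_rel_trans G).

Definition nonunit_class (G : groupType) : choiceType :=
  {eq_quot nonunit_equiv_rel G}%qT.

Definition class_of (G : groupType) (K : nonunit_ggraph G) : nonunit_class G :=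
  \pi_({eq_quot nonunit_equiv_rel G})%qT (K : {classic nonunit_ggraph G}).

Definition S_space (G : groupType) : lmodType 'F_2 := {freeg (nonunit_class G) / 'F_2}.

Section SpliceAxioms.
Variables (G : groupType) (V H : finType).
Variables (K : graph_data G V H) (D : {set V}) (j : H -> H).
Hypotheses (Kfr : framed_4graph K) (Kss : source_sink K).
Hypotheses (jK : involutive j) (jout : forall h, vtx K h \notin D -> j h = h).
Hypothesis jdel : forall h, vtx K h \in D -> j h = h ->
  vtx K (edge K h) \in D /\ j (edge K h) = edge K h.
Hypothesis jflip : forall h, j h != h -> out K (j h) = ~~ out K h.

Let q := edge K \o j.

Let eK : involutive (edge K). Proof. by case: Kfr. Qed.

Let q_inj : injective q.
Proof. exact: inj_comp (inv_inj eK) (inv_inj jK). Qed.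

Let j_in h : vtx K h \in D -> vtx K (j h) \in D.
Proof.
move=> hD; apply: contraT => jhD.
have jh : h = j h by have := jout jhD; rewrite jK.
by rewrite -jh hD in jhD.
Qed.

Let qjq x : q (j (q x)) = j x.
Proof. by rewrite /q /= jK eK. Qed.

Let exit_ex h : vtx K h \notin D ->
  exists i, [/\ splice_exit K D j h = iter i.+1 q h,
    vtx K (iter i.+1 q h) \notin D
    & forall m, (m < i)%N -> vtx K (iter m.+1 q h) \in D].
Proof.
move=> hD; rewrite /splice_exit -/q.
have qh : edge K h = q h by rewrite /q /= (jout hD).
rewrite qh; set s := traject _ _ _; pose p := fun k => vtx K k \notin D; rewrite -/p.
have szs : size s = #|H| by rewrite size_traject.
have hs : has p s.
  apply/hasP; exists h => //; apply/trajectP.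
  exists (order q h).-1.
    by rewrite prednK ?order_gt0 // /order max_card.
  by rewrite -iterSr prednK ?order_gt0 // iter_order.
have lti : (find p s < #|H|)%N by rewrite -szs -has_find.
have nthE m : (m < #|H|)%N -> nth h s m = iter m.+1 q h.
  by move=> lt_m; rewrite (set_nth_default (q h)) ?szs // nth_traject // iterSr.
exists (find p s); split; first by rewrite nthE.
  by have := nth_find h hs; rewrite nthE.
move=> m lt_m; have := before_find h lt_m.
by rewrite nthE ?(ltn_trans lt_m) // /p => /negbFE.
Qed.

Let exit_uniq h i : vtx K h \notin D -> vtx K (iter i.+1 q h) \notin D ->
  (forall m, (m < i)%N -> vtx K (iter m.+1 q h) \in D) ->
  splice_exit K D j h = iter i.+1 q h.
Proof.
move=> hD iD mD; have [i0 [-> i0D m0D]] := exit_ex hD.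
case: (ltngtP i i0) => [lt|lt|-> //].
  by rewrite (m0D _ lt) in iD.
by rewrite (mD _ lt) in i0D.
Qed.

Let nofix h i : vtx K h \notin D ->
  (forall m, (m < i)%N -> vtx K (iter m.+1 q h) \in D) ->
  forall m, (m < i)%N -> j (iter m.+1 q h) != iter m.+1 q h.
Proof.
move=> hD mD; elim=> [|m IH] lt_m; apply/eqP => fx.
  have [/= eD ej] := jdel (mD _ lt_m) fx.
  by move: eD; rewrite /q /= eK (jout hD) (negPf hD).
have := IH (ltnW lt_m); have [_] := jdel (mD _ lt_m) fx.
rewrite iterS; set x := iter m.+1 q h.
have -> : edge K (q x) = j x by rewrite /q /= eK.
by rewrite jK => <-; rewrite eqxx.
Qed.

Let out_exit h : vtx K h \notin D -> out K (splice_exit K D j h) = ~~ out K h.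
Proof.
move=> hD; have [i [-> iD mD]] := exit_ex hD.
have nf := nofix hD mD; have [Ke _] := Kss.
suff: forall m, (m <= i)%N -> out K (iter m.+1 q h) = ~~ out K h by apply.
elim=> [|m IH] le_m; first by rewrite /= /q /= Ke (jout hD).
by rewrite iterS {1}/q /= Ke jflip ?negbK ?(IH (ltnW le_m)) ?nf.
Qed.

Let exit_in h : vtx K h \notin D -> vtx K (splice_exit K D j h) \notin D.
Proof. by move=> hD; have [i [-> ->]] := exit_ex hD. Qed.

Let exitK h : vtx K h \notin D ->
  splice_exit K D j (splice_exit K D j h) = h.
Proof.
move=> hD; have [i [eqi iD mD]] := exit_ex hD.
rewrite eqi; set k := iter i.+1 q h in iD *.
have qk n : (n <= i.+1)%N -> iter n q k = j (iter (i.+1 - n) q h).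
  elim: n => [|n IH] le_n; first by rewrite subn0 /= (jout iD).
  rewrite iterS IH 1?ltnW //.
  by rewrite -(prednK (n := i.+1 - n)) ?subn_gt0 // iterS qjq subnS.
rewrite (exit_uniq (i := i)) //.
- by rewrite qk // subnn (jout hD).
- by rewrite qk // subnn (jout hD).
move=> m lt_m; rewrite qk 1?ltnW //; apply: j_in.
by rewrite subSS -(prednK (n := i - m)) ?subn_gt0 //; apply: mD; lia.
Qed.

Lemma splice_framed : framed_4graph (splice K D j).
Proof.
have [_ _ c4 oK oV] := Kfr.
have valE (h : {h : H | vtx K h \notin D}) :
    val (edge (splice K D j) h) = splice_exit K D j (val h).
  by rewrite /= val_insubd exit_in // (valP h).
have valO (h : {h : H | vtx K h \notin D}) :
    val (opp (splice K D j) h) = opp K (val h).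
  by rewrite /= val_insubd (oV _).2 (valP h).
split.
- by move=> h; apply: val_inj; rewrite !valE exitK // (valP h).
- move=> h; apply/eqP => /(congr1 (fun h => out K (val h))).
  by rewrite valE out_exit ?(valP h) //; case: (out K _).
- move=> v; rewrite -(c4 (val v)) -(card_imset _ val_inj).
  apply: eq_card => h; rewrite inE; apply/imsetP/eqP => [[h' + ->]|hv].
    by rewrite inE => /eqP <-.
  have hD : vtx K h \notin D by rewrite hv (valP v).
  exists (Sub h hD) => //; rewrite inE; apply/eqP/val_inj; exact: hv.
- by move=> h; apply: val_inj; rewrite !valO oK.
move=> h; split; first by rewrite -val_eqE valO (oV _).1.
by apply: val_inj; rewrite [LHS](congr1 (vtx K) (valO h)) (oV _).2.
Qed.

Lemma splice_source_sink : source_sink (splice K D j).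
Proof.
have [Ke Kv] := Kss; have [_ _ _ _ oV] := Kfr; split.
  by move=> h; rewrite /= val_insubd exit_in ?out_exit ?(valP h).
move=> h k /(congr1 val)/= /Kv ->.
by rewrite -!val_eqE /= val_insubd (oV _).2 (valP h).
Qed.

End SpliceAxioms.

Section Normalise.
Variables (G : groupType) (V H : finType) (K : graph_data G V H).

Definition ord_data : graph_data G 'I_#|V| 'I_#|H| := {|
  vtx := fun i => enum_rank (vtx K (enum_val i));
  edge := fun i => enum_rank (edge K (enum_val i));
  opp := fun i => enum_rank (opp K (enum_val i));
  out := fun i => out K (enum_val i);
  label := fun i => label K (enum_val i);
  circles := circles K
|}.

Lemma ord_data_framed : framed_4graph K -> framed_4graph ord_data.
Proof.
move=> [eK e0 c4 oK oV]; split.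
- by move=> h; rewrite /= enum_rankK eK enum_valK.
- by move=> h; rewrite -(inj_eq enum_val_inj) /= enum_rankK e0.
- move=> v; rewrite -(c4 (enum_val v)) -(card_imset _ enum_val_inj).
  apply: eq_card => h; rewrite inE; apply/imsetP/eqP => [[h' + ->]|hv].
    by rewrite inE => /eqP <-; rewrite /= enum_rankK.
  by exists (enum_rank h); rewrite ?inE /= enum_rankK // hv enum_valK.
- by move=> h; rewrite /= enum_rankK oK enum_valK.
by move=> h; rewrite -(inj_eq enum_val_inj) /= enum_rankK (oV _).1 (oV _).2.
Qed.

Lemma ord_data_source_sink : source_sink K -> source_sink ord_data.
Proof.
move=> [Ke Kv]; split=> [h|h k]; first by rewrite /= enum_rankK Ke.
by move=> /enum_rank_inj/Kv /= ->; rewrite -!(inj_eq enum_val_inj) enum_rankK.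
Qed.

Definition ord_ggraph (Kfr : framed_4graph K) (Kss : source_sink K) : ggraph G :=
  GGraph (ord_data_framed Kfr) (ord_data_source_sink Kss).

End Normalise.

Section Smoothing.
Variables (G : groupType) (K : ggraph G).

Definition unit_vertices : {set 'I_(nvert K)} := [set v | label K v == 1%g].

(* A way of smoothing all the unit vertices, as the involution which exchanges
   the half-edges joined at these vertices. *)
Definition smoothing_way (j : {ffun 'I_(nhalf K) -> 'I_(nhalf K)}) : bool :=
  [forall h, if vtx K h \in unit_vertices
             then adjacent K h (j h) && (j (j h) == h) else j h == h].

Definition smoothing : finType := {j | smoothing_way j}.

Definition smooth_data (s : smoothing) := splice K unit_vertices (val s).

Lemma smoothing_splice (s : smoothing) : let j := val s in
  [/\ involutive j, forall h, vtx K h \notin unit_vertices -> j h = h,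
      forall h, vtx K h \in unit_vertices -> j h = h ->
        vtx K (edge K h) \in unit_vertices /\ j (edge K h) = edge K h
    & forall h, j h != h -> out K (j h) = ~~ out K h].
Proof.
case: s => j /= /forallP jP; split=> [h|h hU|h hU jh|h jh].
- by move: (jP h); case: ifP => _ => [/andP[_ /eqP]|/eqP fx] //; rewrite !fx.
- by move: (jP h); rewrite (negPf hU) => /eqP.
- by move: (jP h); rewrite hU /adjacent jh !eqxx.
move: (jP h); case: ifP => _; last by rewrite (negPf jh).
have [_ Kv] := gsource_sink K.
case/andP=> /and3P[/eqP /Kv + n1 n2] _; rewrite (negPf n1) (negPf n2).
by case: (out K h); case: (out K _).
Qed.

Lemma smooth_framed (s : smoothing) : framed_4graph (smooth_data s).
Proof.
have [jK jo jd jf] := smoothing_splice s.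
exact: splice_framed (gframed K) (gsource_sink K) jK jo jd jf.
Qed.

Lemma smooth_source_sink (s : smoothing) : source_sink (smooth_data s).
Proof.
have [jK jo jd jf] := smoothing_splice s.
exact: splice_source_sink (gframed K) (gsource_sink K) jK jo jd jf.
Qed.

Definition smooth_ggraph (s : smoothing) : ggraph G :=
  ord_ggraph (smooth_framed s) (smooth_source_sink s).

Lemma smooth_nonunit (s : smoothing) : nonunit (smooth_ggraph s).
Proof.
by move=> v /=; case: (enum_val v) => w /= + w1; rewrite inE w1 eqxx.
Qed.

Definition smooth (s : smoothing) : nonunit_ggraph G :=
  exist _ (smooth_ggraph s) (@smooth_nonunit s).

Definition unit_bracket : S_space G :=
  (\sum_(s : smoothing | ncomp (smooth_ggraph s) == 1) << class_of (smooth s) >>)%R.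

End Smoothing.

(* Main.v *)
From Stdlib Require Import Relation_Operators.
From mathcomp Require Import all_boot all_algebra perm.
From mathcomp Require Import boolp freeg.
Require Import Defs.

(** The bracket is invariant for the reason that makes the Kauffman bracket
    invariant.  It satisfies a skein relation: at a vertex labeled by the unit it
    is the sum of the brackets of the two smoothings at that vertex ([skein]).
    Each move is then checked on the few vertices that it involves, for arbitrary
    G-graphs.

    - First move ([bracket_r1]).  One smoothing cuts the loop off as a circle,
      which forces a second component and makes the bracket vanish; the other one
      is the result of the move.
    - Second move ([bracket_r2]).  If the two labels are not the unit, the move
      can be performed after the smoothings, and it is then one of the relations
      of the target space.  If both are the unit, smoothing one vertex in the
      first way leaves a first move on the other vertex.  Smoothing it in the
      second way and then smoothing the other vertex gives two graphs; one is the
      result of the second move, the other is isomorphic to the result of the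
      first move just mentioned, and these two cancel modulo 2.
    - Third move ([bracket_r3]).  If no label is the unit, the move can again be
      performed after the smoothings.  Otherwise the triangle can be rotated so
      that A is labeled by the unit, and then the labels of B and C are mutually
      inverse.  Smoothing A along the corner of the triangle creates a bigon
      between B and C on either side of the move, and the second move removes it
      with the same result.  The other smoothings at A are isomorphic, by an
      isomorphism that exchanges B and C.  Both are compared before any other
      vertex is smoothed, so it does not matter whether b and c are the unit.

    What remains is to compare graphs obtained by several successive deletions of
    vertices.  In [splice K D j] the new edges and circles are connected components
    of the relation generated on half-edges by [edge K] and j, so everything is
    reduced to connectedness: [splice_iso] recognizes a splice from
    which half-edges are connected and from the number of circles, [splice_splice]
    composes two splices into one, and [splice_bypass] replaces a joined path by a
    shorter one.  The number of components of a splice is itself a number of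
    circles, since a component becomes a circle once every half-edge is joined to
    its opposite ([ncomp_splice]). *)

Set Implicit Arguments.
Unset Strict Implicit.
Unset Printing Implicit Defensive.

Import GRing.Theory.

(** Decides the tests [a == b] whose outcome is given by a disequality in the
    context, in either direction. *)
Ltac eq_simp := repeat match goal with
 | |- context [?a == ?a] => rewrite (eqxx a)
 | H : is_true (?a != ?b) |- context [?a == ?b] => rewrite (negPf H)
 | H : is_true (?a != ?b) |- context [?b == ?a] => rewrite (eq_sym b a) (negPf H)
 end; rewrite /=.

Ltac split_ands := repeat match goal with
 | H : is_true (_ && _) |- _ => let H1 := fresh in let H2 := fresh in
     case/andP: H => H1 H2
 end.
Ltac split_ors := repeat match goal with
 | |- is_true (_ || _) -> _ => case/orP
 end.

(** Computes transpositions of elements that the context declares distinct. *)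
Ltac tperm_simp := repeat match goal with
 | |- context [fun_of_perm (tperm ?x ?y) ?x] => rewrite (tpermL x y)
 | |- context [fun_of_perm (tperm ?x ?y) ?y] => rewrite (tpermR x y)
 | |- context [fun_of_perm (tperm ?x ?y) ?z] =>
     rewrite (@tpermD _ x y z); [| by eq_simp | by eq_simp]
 end.

(** * Components of a partially joined set of half-edges *)

Lemma inj_surj_bij (S T : finType) (f : S -> T) :
  injective f -> (forall y, exists x, f x = y) -> bijective f.
Proof.
move=> f_inj f_surj; apply: inj_card_bij => //.
rewrite -(card_codom f_inj); apply/subset_leq_card/subsetP => y _.
by have [x <-] := f_surj y; apply: codom_f.
Qed.

(** The counting principle behind all comparisons of circles: a map that
    preserves and reflects connectedness, and meets every class, matches the
    classes.  It is [adjunction_n_comp] with propositional hypotheses. *)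
Lemma n_comp_adjunction (T S : finType) (h : S -> T) (e : rel T) (e' : rel S)
    (a : pred T) (a' : pred S) :
  symmetric e -> symmetric e' -> closed e a ->
  (forall x, a x -> exists x', connect e x (h x')) ->
  (forall x' y', a (h x') -> connect e' x' y' = connect e (h x') (h y')) ->
  (forall x', a' x' = a (h x')) ->
  n_comp e a = n_comp e' a'.
Proof.
move=> se se' cl_a h_surj h_fun a'E.
rewrite (adjunction_n_comp h (sym_connect_sym se) (sym_connect_sym se') cl_a).
  by apply: eq_n_comp_r => x; rewrite [RHS]a'E.
split=> [x xa|x' y' xa]; last exact: h_fun.
by apply: sigW; apply: h_surj.
Qed.

Section Wires.
Variable T : finType.
Implicit Types (e j : T -> T) (D : pred T).

(** Half-edges linked by an edge e or by a joining j.  When e and j are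
    involutions, each class is a path or a cycle. *)
Definition link e j : rel T := fun h k => (k == e h) || (k == j h).

(** The half-edges of a cycle which is entirely deleted (D) and entirely joined
    (no fixed point of j): such a cycle is a new circle. *)
Definition loop_class e j D : pred T :=
  [pred h | [forall k, connect (link e j) h k ==> D k && (j k != k)]].

Definition wire_loops e j D : nat := n_comp (link e j) (loop_class e j D).

Lemma link_sym e j : involutive e -> involutive j -> symmetric (link e j).
Proof.
move=> eK jK h k; rewrite /link.
by rewrite -(inv_eq eK) -(inv_eq jK) ![_ == h]eq_sym.
Qed.

Lemma link_csym e j : involutive e -> involutive j ->
  connect_sym (link e j).
Proof. by move=> eK jK; apply: sym_connect_sym; apply: link_sym. Qed.

Lemma link_e e j h : connect (link e j) h (e h).
Proof. by rewrite connect1 // /link eqxx. Qed.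

Lemma link_j e j h : connect (link e j) h (j h).
Proof. by rewrite connect1 // /link eqxx orbT. Qed.

Lemma link_ind e j (P : T -> Prop) h :
  P h -> (forall x, P x -> P (e x)) -> (forall x, P x -> P (j x)) ->
  forall k, connect (link e j) h k -> P k.
Proof.
move=> Ph Pe Pj k /connectP[p + ->]; elim: p h Ph => //= x p IH h Ph.
by case/andP=> /orP[]/eqP-> /IH; apply; auto.
Qed.

Lemma loop_classP e j D h :
  reflect (forall k, connect (link e j) h k -> D k /\ j k <> k)
          (loop_class e j D h).
Proof.
apply: (iffP forallP) => [Ph k hk|Ph k].
  by move/implyP: (Ph k) => /(_ hk) /andP[? /eqP].
by apply/implyP => /Ph[-> /eqP].
Qed.

Lemma loop_class_closed e j D : involutive e -> involutive j ->
  closed (link e j) (loop_class e j D).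
Proof.
move=> eK jK; apply: (intro_closed (link_csym eK jK)) => h k hk /loop_classP Ph.
by apply/loop_classP => x kx; apply: Ph; apply: connect_trans kx; apply: connect1.
Qed.

Lemma eq_link e e' j j' : e =1 e' -> j =1 j' -> link e j =2 link e' j'.
Proof. by move=> ee jj h k; rewrite /link ee jj. Qed.

Lemma eq_wire_loops e e' j j' D D' : e =1 e' -> j =1 j' -> D =1 D' ->
  wire_loops e j D = wire_loops e' j' D'.
Proof.
move=> ee jj DD; have cc := eq_connect (eq_link ee jj).
rewrite /wire_loops (eq_n_comp cc); apply: eq_n_comp_r => h.
by apply/loop_classP/loop_classP => Ph k; [rewrite -cc|rewrite cc];
  move/Ph; rewrite DD jj.
Qed.

End Wires.

(** Relabeling half-edges keeps the number of circles. *)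
Lemma wire_loops_bij (T S : finType) (f : T -> S) e j D e' j' D' :
  bijective f -> involutive e -> involutive j ->
  involutive e' -> involutive j' ->
  (forall h, e' (f h) = f (e h)) -> (forall h, j' (f h) = f (j h)) ->
  (forall h, D' (f h) = D h) ->
  wire_loops e j D = wire_loops e' j' D'.
Proof.
move=> [g gK fK] eK jK eK' jK' fe fj fD.
have fc h k : connect (link e j) h k = connect (link e' j') (f h) (f k).
  apply/idP/idP.
    move: k; apply: link_ind => [|x hx|x hx]; first exact: connect0.
      by rewrite -fe; apply: connect_trans hx (link_e _ _ _).
    by rewrite -fj; apply: connect_trans hx (link_j _ _ _).
  rewrite -{2}[k]gK; move: (f k); apply: link_ind => [|x hx|x hx].
  - by rewrite gK connect0.
  - by rewrite -{1}[x]fK fe gK; apply: connect_trans hx (link_e _ _ _).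
  - by rewrite -{1}[x]fK fj gK; apply: connect_trans hx (link_j _ _ _).
symmetry; apply: (@n_comp_adjunction _ _ f).
- exact: link_sym.
- exact: link_sym.
- exact: loop_class_closed.
- by move=> x _; exists (g x); rewrite fK connect0.
- by move=> x y _; rewrite fc.
move=> x; apply/loop_classP/loop_classP => Px k.
  rewrite -[k]fK -fc => /Px; rewrite fD fj => -[-> nf]; split=> //.
  by move/(can_inj gK).
rewrite fc => /Px; rewrite fD fj => -[-> nf]; split=> // jk.
by rewrite jk in nf.
Qed.

(** Half-edges in D1 are joined by j1; the remaining ones, a copy f of S, have
    [e1] as new edges.  A second joining j2 on S amounts to the joining J that is
    j1 on D1 and j2 outside. *)
Section WireComposition.
Variables (T S : finType) (f : S -> T) (e j1 J : T -> T) (D1 D : pred T).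
Variables (e1 j2 : S -> S) (D2 : pred S).
Hypotheses (f_inj : injective f) (f_live : forall h, D1 (f h) = false).
Hypothesis f_surj : forall x, ~~ D1 x -> exists h, f h = x.
Hypotheses (eK : involutive e) (j1K : involutive j1).
Hypothesis j1live : forall x, ~~ D1 x -> j1 x = x.
Hypothesis e1P : forall h, connect (link e j1) (f h) (f (e1 h)).
Hypothesis e1_uniq : forall h k,
  connect (link e j1) (f h) (f k) -> k = h \/ k = e1 h.
Hypotheses (JD1 : forall x, D1 x -> J x = j1 x).
Hypotheses (Jf : forall h, J (f h) = f (j2 h)).

Lemma sub_connect x y : connect (link e j1) x y -> connect (link e J) x y.
Proof.
move: y; apply: link_ind => [|z xz|z xz]; first exact: connect0.
  exact: connect_trans xz (link_e _ _ _).
have [zD|zD] := boolP (D1 z); last by rewrite j1live.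
by rewrite -JD1 //; apply: connect_trans xz (link_j _ _ _).
Qed.

(** A path for J is cut at the half-edges outside D1: between two of them it
    stays in one class of j1, that is, on one new edge. *)
Lemma connect_project h x : connect (link e J) (f h) x ->
  exists2 k, connect (link e1 j2) h k & connect (link e j1) (f k) x.
Proof.
move: x; apply: link_ind => [|x [k hk kx]|x [k hk kx]].
- by exists h; apply: connect0.
- by exists k => //; apply: connect_trans kx (link_e _ _ _).
have [xD|xD] := boolP (D1 x).
  by exists k => //; rewrite JD1 //; apply: connect_trans kx (link_j _ _ _).
have [k' kk'] := f_surj xD; subst x.
exists (j2 k'); last by rewrite Jf connect0.
apply: connect_trans hk _; have [->|->] := e1_uniq kx; first exact: link_j.
exact: connect_trans (link_e _ _ _) (link_j _ _ _).
Qed.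

Lemma connect_composite h k :
  connect (link e1 j2) h k = connect (link e J) (f h) (f k).
Proof.
apply/idP/idP.
  move: k; apply: link_ind => [|x hx|x hx]; first exact: connect0.
    exact: connect_trans hx (sub_connect (e1P _)).
  by rewrite -Jf; apply: connect_trans hx (link_j _ _ _).
case/connect_project=> k' hk' /e1_uniq[->|->] //.
exact: connect_trans hk' (link_e _ _ _).
Qed.

Hypotheses (e1K : involutive e1) (j2K : involutive j2) (JK : involutive J).
Hypotheses (D1D : forall x, D1 x -> D x) (fD : forall h, D (f h) = D2 h).
Hypothesis live_closed : forall h x,
  D1 x -> connect (link e j1) (f h) x -> j1 x <> x.

(** A circle of the composite either avoids the half-edges outside D1, and then
    was created by the first joining, or meets them, and then is created by the
    second one. *)
Lemma wire_loops_composite :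
  wire_loops e J D = wire_loops e j1 D1 + wire_loops e1 j2 D2.
Proof.
have csJ := link_csym eK JK.
pose a := loop_class e J D.
(* The classes that meet the half-edges outside D1. *)
pose b : pred T := [pred x | [exists h, connect (link e J) x (f h)]].
have cla : closed (link e J) a by apply: loop_class_closed.
have clb : closed (link e J) b.
  apply: (intro_closed csJ) => x y xy /existsP[h xh]; apply/existsP; exists h.
  by apply: connect_trans xh; rewrite csJ connect1.
have -> : wire_loops e J D = n_comp (link e J) [predI a & [predC b]] +
    n_comp (link e J) [predI a & b].
  rewrite /wire_loops -/a /n_comp_mem addnC.
  rewrite -(cardID b); congr (_ + _); apply: eq_card => x.
    by rewrite /in_mem /= /in_mem /= /in_mem /= andbA.
  by rewrite /in_mem /= /in_mem /= /in_mem /= andbC -andbA.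
congr (_ + _).
  have Jb x y : ~~ b x -> connect (link e J) x y ->
      connect (link e j1) x y.
    move=> bx; suff: connect (link e J) x y ->
       connect (link e j1) x y /\ ~~ b y by move=> P /P[].
    move: y; apply: link_ind => [|z [xz bz]|z [xz bz]]; first by rewrite connect0.
      split; first exact: connect_trans xz (link_e _ _ _).
      by have /= := clb z (e z); rewrite /in_mem /= => <- //; rewrite /link eqxx.
    have zD : D1 z.
      apply: contraR bz => /f_surj[h <-]; apply/existsP.
      by exists h; rewrite connect0.
    split; first by rewrite JD1 //; exact: connect_trans xz (link_j _ _ _).
    by have /= := clb z (J z); rewrite /in_mem /= => <- //; rewrite /link eqxx orbT.
  have bD y : ~~ b y -> D1 y.
    by move=> by_; apply: contraR by_ => /f_surj[h <-]; apply/existsP;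
      exists h; rewrite connect0.
  have aD1 x : loop_class e j1 D1 x = a x && ~~ b x.
    apply/loop_classP/andP.
      move=> Px; have xb : ~~ b x.
        apply/negP => /existsP[h]; rewrite csJ => /connect_project[k _].
        by rewrite (link_csym eK j1K) => /Px[]; rewrite f_live.
      split=> //; apply/loop_classP => k /(Jb _ _ xb) /Px[kD nf].
      by rewrite JD1 // D1D.
    case=> /loop_classP Px xb k xk; have xkJ := sub_connect xk.
    have kb : ~~ b k.
      by have /= := closed_connect clb xkJ; rewrite /in_mem /= => <-.
    have kD := bD _ kb.
    by have [_] := Px _ xkJ; rewrite JD1.
  apply: (@n_comp_adjunction _ _ id).
  - exact: link_sym.
  - exact: link_sym.
  - move=> x y xy; have := cla x y xy; have := clb x y xy.
    by rewrite /in_mem /= => -> ->.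
  - by move=> x _; exists x; rewrite connect0.
  - move=> x y /andP[_ xb]; apply/idP/idP; first exact: sub_connect.
    exact: Jb.
  by move=> x; rewrite aD1.
apply: (@n_comp_adjunction _ _ f).
- exact: link_sym.
- exact: link_sym.
- move=> x y xy; have := cla x y xy; have := clb x y xy.
  by rewrite /in_mem /= => -> ->.
- by move=> x /andP[_ /existsP].
- by move=> x y _; rewrite connect_composite.
move=> h; have -> : [predI a & b] (f h) = a (f h).
  by apply: andb_idr => _; apply/existsP; exists h; rewrite connect0.
apply/loop_classP/loop_classP => Ph x.
  case/connect_project => k hk kx.
  have [xD|xD] := boolP (D1 x).
    by split; [exact: D1D | rewrite JD1 //; apply: live_closed kx].
  have [k' kk'] := f_surj xD; subst x.
  have /Ph[] : connect (link e1 j2) h k'.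
    have [->//|->] := e1_uniq kx; exact: connect_trans hk (link_e _ _ _).
  by rewrite -fD Jf => -> nf; split=> // /f_inj.
rewrite connect_composite => /Ph[]; rewrite fD Jf => -> nf; split=> //.
by move=> ek; rewrite ek in nf.
Qed.
End WireComposition.

(** * Shortening a joined path *)

(** In a path p - x - e x - q, where p = j x and q = j (e x), the new joining
    links p directly to q and leaves x and e x unjoined, that is, deleted.  If x is
    fixed by j, then q becomes fixed, and symmetrically. *)
Definition bypass (T : eqType) (e j : T -> T) (x h : T) : T :=
  if (h == x) || (h == e x) then h
  else if j h == x then if j (e x) == e x then h else j (e x)
  else if j h == e x then if j x == x then h else j x
  else j h.

Section Bypass.
Variables (T : finType) (e j : T -> T) (D : pred T) (x : T).
Hypotheses (eK : involutive e) (jK : involutive j).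
Hypotheses (ex_neq : e x != x) (jx_neq : j x != e x).
Hypotheses (xD : D x) (yD : D (e x)).

Local Notation y := (e x).
Local Notation j' := (bypass e j x).

(** Moves x and e x along their path to a half-edge that keeps its class. *)
Let rep h : T :=
  if h == x then if j x == x then if j y == y then x else j y else j x
  else if h == y then if j y == y then if j x == x then y else j x else j y
  else h.

Let jy_neq : j y != x.
Proof. by rewrite (inv_eq jK) eq_sym. Qed.

Let bp_x : j' x = x. Proof. by rewrite /bypass eqxx. Qed.
Let bp_y : j' y = y. Proof. by rewrite /bypass eqxx orbT. Qed.

Let bp_jx : j x != x -> j' (j x) = if j y == y then j x else j y.
Proof. by move=> /negPf px; rewrite /bypass px (negPf jx_neq) jK eqxx. Qed.

Let bp_jy : j y != y -> j' (j y) = if j x == x then j y else j x.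
Proof.
by move=> /negPf qy; rewrite /bypass qy (negPf jy_neq) jK eqxx (negPf ex_neq).
Qed.

Let bp_other h : h != x -> h != y -> h != j x -> h != j y -> j' h = j h.
Proof.
move=> /negPf hx /negPf hy; rewrite -!(inv_eq jK) => /negPf jhx /negPf jhy.
by rewrite /bypass hx hy jhx jhy.
Qed.

Let bp_cases (P : T -> Prop) : P x -> P y -> (j x != x -> P (j x)) ->
  (j y != y -> P (j y)) ->
  (forall h, h != x -> h != y -> h != j x -> h != j y -> P h) -> forall h, P h.
Proof.
move=> Px Py Pp Pq Po h.
have [->//|hx] := eqVneq h x; have [->//|hy] := eqVneq h y.
have [hp|hp] := eqVneq h (j x); first by subst h; exact: Pp.
by have [hq|hq] := eqVneq h (j y); [subst h; exact: Pq|exact: Po].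
Qed.

Lemma bypass_inv : involutive j'.
Proof.
apply: bp_cases => [||px|qy|h hx hy hp hq]; rewrite ?bp_x ?bp_y //.
- have [qy|qy] := eqVneq (j y) y; rewrite !(bp_jx px).
    by rewrite qy eqxx (bp_jx px) qy eqxx.
  by rewrite (negPf qy) bp_jy // (negPf px).
- have [px|px] := eqVneq (j x) x; rewrite !(bp_jy qy).
    by rewrite px eqxx (bp_jy qy) px eqxx.
  by rewrite (negPf px) bp_jx // (negPf qy).
rewrite (bp_other hx hy hp hq) bp_other ?jK //; rewrite ?(inj_eq (inv_inj jK)) //.
  by rewrite (inv_eq jK).
by rewrite (inv_eq jK).
Qed.

Lemma bypass_live : (forall h, ~~ D h -> j h = h) ->
  forall h, ~~ D h -> j' h = h.
Proof.
move=> jl h hD; rewrite /bypass (jl h hD).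
have /negPf-> : h != x by apply: contraNneq hD => ->.
by have /negPf-> : h != y by apply: contraNneq hD => ->.
Qed.

Lemma bypass_connect a b : connect (link e j') a b -> connect (link e j) a b.
Proof.
have cs := link_csym eK jK.
have xy : connect (link e j) x y by apply: link_e.
have jx z : j z = x -> connect (link e j) z x by move <-; apply: link_j.
have jy z : j z = y -> connect (link e j) z y by move <-; apply: link_j.
move: b; apply: link_ind => [|z az|z az]; first exact: connect0.
  exact: connect_trans az (link_e _ _ _).
apply: connect_trans az _; rewrite /bypass.
case: ifP => _; first exact: connect0.
case: eqP => [/jx zx|_].
  case: ifP => _; first exact: connect0.
  exact: connect_trans zx (connect_trans xy (link_j _ _ _)).
case: eqP => [/jy zy|_]; last exact: link_j.
case: ifP => _; first exact: connect0.
by apply: connect_trans zy (connect_trans _ (link_j _ _ _)); rewrite cs.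
Qed.

Let c1 a b : link e j' a b -> connect (link e j') a b. Proof. exact: connect1. Qed.

Let rep_connect a : connect (link e j) a (rep a).
Proof.
have xy : connect (link e j) x y by apply: link_e.
rewrite /rep; case: eqP => [->|_].
  case: ifP => _; last exact: link_j.
  by case: ifP => _; [exact: connect0 | exact: connect_trans xy (link_j _ _ _)].
case: eqP => [->|_]; last exact: connect0.
rewrite (link_csym eK jK) in xy.
case: ifP => _; last exact: link_j.
by case: ifP => _; [exact: connect0 | exact: connect_trans xy (link_j _ _ _)].
Qed.

Let rep_x : rep x = if j x == x then if j y == y then x else j y else j x.
Proof. by rewrite /rep eqxx. Qed.

Let rep_y : rep y = if j y == y then if j x == x then y else j x else j y.
Proof. by rewrite /rep (negPf ex_neq) eqxx. Qed.

Let rep_id h : h != x -> h != y -> rep h = h.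
Proof. by rewrite /rep => /negPf-> /negPf->. Qed.

Let rep_xy : connect (link e j') (rep x) (rep y).
Proof.
rewrite rep_x rep_y.
case: (eqVneq (j x) x) => px; case: (eqVneq (j y) y) => qy; rewrite ?connect0 //.
  exact: link_e.
by have := link_j e j' (j x); rewrite bp_jx // (negPf qy).
Qed.

Let rep_step_e a : connect (link e j') (rep a) (rep (e a)).
Proof.
have [->|ax] := eqVneq a x; first exact: rep_xy.
have [->|ay] := eqVneq a y.
  by rewrite eK (link_csym eK bypass_inv) rep_xy.
rewrite !rep_id //; first exact: link_e.
  by rewrite (inv_eq eK).
by rewrite (inj_eq (inv_inj eK)).
Qed.

Let rep_step_j a : connect (link e j') (rep a) (rep (j a)).
Proof.
have pq : j x != x -> rep (j x) = rep x.
  by move=> px; rewrite rep_id // rep_x (negPf px).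
have qp : j y != y -> rep (j y) = rep y.
  by move=> qy; rewrite rep_id // rep_y (negPf qy).
move: a; apply: bp_cases => [||px|qy|h hx hy hp hq].
- by have [->|px] := eqVneq (j x) x; rewrite ?pq // connect0.
- by have [->|qy] := eqVneq (j y) y; rewrite ?qp // connect0.
- by rewrite jK pq // connect0.
- by rewrite jK qp // connect0.
rewrite !rep_id //; last 2 first.
- by rewrite (inv_eq jK).
- by rewrite (inv_eq jK).
by rewrite -(bp_other hx hy hp hq) link_j.
Qed.

(** The paths of j are carried to paths of the bypass by [rep]; this suffices
    because the bypass only identifies half-edges that j already connects. *)
Lemma connect_bypass_rep a b : connect (link e j) a b ->
  connect (link e j') (rep a) (rep b).
Proof.
move: b; apply: link_ind => [|z az|z az]; first exact: connect0.
  exact: connect_trans az (rep_step_e _).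
exact: connect_trans az (rep_step_j _).
Qed.

Lemma connect_bypass a b : a != x -> a != y -> b != x -> b != y ->
  connect (link e j') a b = connect (link e j) a b.
Proof.
move=> /negPf ax /negPf ay /negPf bx /negPf by_; apply/idP/idP.
  exact: bypass_connect.
by move/connect_bypass_rep; rewrite /rep ax ay bx by_.
Qed.

Let repE a b : connect (link e j) a b = connect (link e j') (rep a) (rep b).
Proof.
apply/idP/idP; first exact: connect_bypass_rep.
move/bypass_connect => ab; apply: connect_trans (rep_connect a) _.
by apply: connect_trans ab _; rewrite (link_csym eK jK) rep_connect.
Qed.

(** The class of x in j corresponds to the class of p and q after the bypass,
    while the class left at x and e x is not counted, x being fixed. *)
Lemma wire_loops_bypass : wire_loops e j' D = wire_loops e j D.
Proof.
apply: (@n_comp_adjunction _ _ rep).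
- exact: link_sym eK bypass_inv.
- exact: link_sym.
- exact: loop_class_closed eK bypass_inv.
- move=> a /loop_classP Pa; exists a; rewrite /rep.
  have ja : j' a <> a by apply: (Pa _ (connect0 _ _)).2.
  have /negPf-> : a != x by apply: contra_notN ja => /eqP->; rewrite /bypass eqxx.
  have /negPf-> : a != y by apply: contra_notN ja => /eqP->; rewrite /bypass eqxx orbT.
  exact: connect0.
- by move=> a b _; rewrite repE.
move=> a; apply/loop_classP/loop_classP => Pa b ab.
  have r_a := rep_connect a.
  have ab' := connect_trans r_a (bypass_connect ab).
  have [bD jb] := Pa _ ab'; split=> //.
  have xy_class z : connect (link e j') z b -> b \in [:: x; y] -> z \in [:: x; y].
    rewrite (link_csym eK bypass_inv) => + bxy; move: z; apply: link_ind => //.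
      move=> z; rewrite !inE => /orP[]/eqP->; first by rewrite eqxx orbT.
      by rewrite eK eqxx.
    by move=> z; rewrite !inE => /orP[]/eqP->; rewrite ?bp_x ?bp_y eqxx ?orbT.
  have bxy : b \notin [:: x; y].
    apply/negP => bxy; have := xy_class _ ab bxy.
    have [qb pb] : j y <> y /\ j x <> x.
      move: (bxy); rewrite !inE => /orP[]/eqP eb; subst b; split=> //.
        exact: (Pa _ (connect_trans ab' (link_e _ _ _))).2.
      have := (Pa _ (connect_trans ab' (link_e _ _ _))).2.
      by rewrite eK.
    move/eqP/negPf: qb => qb; move/eqP/negPf: pb => pb.
    have [->|ax] := eqVneq a x; first by rewrite rep_x pb !inE pb (negPf jx_neq).
    have [->|ay] := eqVneq a y; first by rewrite rep_y qb !inE qb (negPf jy_neq).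
    by rewrite rep_id // !inE (negPf ax) (negPf ay).
  move: bxy; rewrite !inE negb_or => /andP[bx by_] fb.
  have [bp|bp] := eqVneq b (j x).
    subst b; move: fb; rewrite bp_jx //; case: eqP => [qy _|_ /(inv_inj jK) ey].
      have [_] := Pa _ (connect_trans ab' (connect_trans (link_j _ _ _) (link_e _ _ _))).
      by rewrite jK.
    by move/eqP: ex_neq; case.
  have [bq|bq] := eqVneq b (j y).
    subst b; move: fb; rewrite bp_jy //; case: eqP => [px _|_ /(inv_inj jK) ey].
      have [_] := Pa _ (connect_trans ab' (connect_trans (link_j _ _ _) (link_e _ _ _))).
      by rewrite jK eK.
    by move/eqP: ex_neq; case.
  by rewrite bp_other in fb.
have [rD rj] := Pa _ (connect_bypass_rep ab).
have [ex|bx] := eqVneq b x; first subst b.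
  split=> // px; move: rj; rewrite rep_x px eqxx; case: eqP => [|/eqP qy]; rewrite ?bp_x //.
  by rewrite bp_jy // px eqxx.
have [ey|by_] := eqVneq b y; first subst b.
  split=> // qy; move: rj; rewrite rep_y qy eqxx; case: eqP => [|/eqP px]; rewrite ?bp_y //.
  by rewrite bp_jx // qy eqxx.
rewrite rep_id // in rD rj; split=> // fb.
by apply: rj; rewrite bp_other //; apply: contraTneq bx => eb;
  [move: fb; rewrite eb jK => <- | move: fb by_; rewrite eb jK => <-]; rewrite ?eqxx.
Qed.
End Bypass.

(** Two classes are two circles when nothing is deleted: used to show that a
    smoothing which cuts off a loop has too many components. *)
Lemma wire_loops_gt1 (T : finType) (e j : T -> T) h k :
  involutive e -> involutive j -> (forall x, j x != x) ->
  ~~ connect (link e j) h k -> 1 < wire_loops e j predT.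
Proof.
move=> eK jK j0 hk; have cs := link_csym eK jK.
have <- : n_comp (link e j) (closure (link e j) (pred2 h k)) = 2.
  by rewrite n_comp_closure2 // hk.
apply/subset_leq_card/subsetP => x /andP[rx _]; apply/andP; split=> //.
by apply/loop_classP => y _; split=> //; apply/eqP.
Qed.

(** * Isomorphisms and the recognition of a splice *)

Definition graph_ok (G : groupType) (V H : finType) (K : graph_data G V H) :=
  framed_4graph K /\ source_sink K.

Section GraphOk.
Variables (G : groupType) (V H : finType) (K : graph_data G V H).
Hypothesis okK : graph_ok K.

Lemma ok_edgeK : involutive (edge K). Proof. by case: okK => -[]. Qed.
Lemma ok_edge_neq h : edge K h != h.
Proof. by case: okK => -[_ + _ _ _] _; apply. Qed.
Lemma ok_oppK : involutive (opp K). Proof. by case: okK => -[]. Qed.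
Lemma ok_opp_neq h : opp K h != h.
Proof. by case: okK => -[_ _ _ _ +] _ => /(_ h)[]. Qed.
Lemma ok_vtx_opp h : vtx K (opp K h) = vtx K h.
Proof. by case: okK => -[_ _ _ _ +] _ => /(_ h)[]. Qed.

End GraphOk.

Section Iso.
Variable G : groupType.

Lemma iso_sym (V H V' H' : finType) (K : graph_data G V H)
    (K' : graph_data G V' H') : iso K K' -> iso K' K.
Proof.
case=> fv [fh [[gv gvK fvK] [[gh ghK fhK] [[v e o] [u l c]]]]].
exists gv, gh; split; first by exists fv.
split; first by exists fh.
split; split=> // h.
- by rewrite -{2}[h]fhK v gvK.
- by rewrite -{2}[h]fhK e ghK.
- by rewrite -{2}[h]fhK o ghK.
- by rewrite -{2}[h]fhK u.
by rewrite -{2}[h]fvK l.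
Qed.

Lemma iso_trans (V H V' H' V'' H'' : finType) (K : graph_data G V H)
    (K' : graph_data G V' H') (K'' : graph_data G V'' H'') :
  iso K K' -> iso K' K'' -> iso K K''.
Proof.
case=> fv [fh [bv [bh [[v e o] [u l c]]]]] [gv [gh [dv [dh [[v' e' o'] [u' l' c']]]]]].
exists (gv \o fv), (gh \o fh); split; first exact: bij_comp.
split; first exact: bij_comp.
split; split; rewrite ?c' ?c // => h /=.
- by rewrite v' v.
- by rewrite e' e.
- by rewrite o' o.
- by rewrite u' u.
by rewrite l' l.
Qed.

Lemma iso_ok (V H V' H' : finType) (K : graph_data G V H)
    (K' : graph_data G V' H') : iso K K' -> graph_ok K -> graph_ok K'.
Proof.
case=> fv [fh [[gv gvK fvK] [[gh ghK fhK] [[v e o] [u l c]]]]].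
have ih := can_inj ghK; have iv := can_inj gvK.
case=> -[eK e0 c4 oK o0] [s1 s2]; split; split.
- by move=> h; rewrite -[h]fhK !e eK.
- by move=> h; rewrite -[h]fhK e (inj_eq ih).
- move=> w; rewrite -(c4 (gv w)) -(card_imset _ ih); apply: eq_card => h.
  rewrite inE; apply/idP/imsetP => [/eqP hw|[h' + ->]].
    by exists (gh h); rewrite ?fhK // inE -(inj_eq iv) -v fhK fvK hw.
  by rewrite inE v => /eqP->; rewrite fvK.
- by move=> h; rewrite -[h]fhK !o oK.
- by move=> h; rewrite -[h]fhK o (inj_eq ih) !v; case: (o0 (gh h)) => -> ->.
- by move=> h; rewrite -[h]fhK e !u.
move=> h k; rewrite -[h]fhK -[k]fhK o !v !u !(inj_eq ih) => /iv; exact: s2.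
Qed.

(** A component is a circle of the joining by opposites. *)
Lemma ncomp_wire_loops (V H : finType) (K : graph_data G V H) :
  framed_4graph K -> ncomp K = circles K + wire_loops (edge K) (opp K) predT.
Proof.
move=> [_ _ _ _ o0]; rewrite /ncomp /wire_loops; congr (_ + _).
apply: eq_n_comp_r => h; rewrite !inE; symmetry; apply/loop_classP => k _.
by split=> //; apply/eqP; case: (o0 k).
Qed.

Lemma iso_ncomp (V H V' H' : finType) (K : graph_data G V H)
    (K' : graph_data G V' H') :
  iso K K' -> graph_ok K -> ncomp K = ncomp K'.
Proof.
move=> KK' gK; have gK' := iso_ok KK' gK.
case: gK gK' => fK _ [fK' _]; rewrite !ncomp_wire_loops //.
case: KK' => fv [fh [bv [bh [[v e o] [u l ->]]]]]; congr (_ + _).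
have [eK _ _ oK _] := fK; have [eK' _ _ oK' _] := fK'.
by apply: (wire_loops_bij bh).
Qed.

End Iso.

Section Exit.
Variables (G : groupType) (V H : finType) (K : graph_data G V H).
Variables (D : {set V}) (j : H -> H).
Hypotheses (eK : involutive (edge K)) (jK : involutive j).
Hypothesis j_live : forall h, vtx K h \notin D -> j h = h.

Local Notation q := (edge K \o j).
Local Notation exit := (splice_exit K D j).

Lemma exit_spec h : vtx K h \notin D ->
  vtx K (exit h) \notin D /\ exists2 i, exit h = iter i.+1 q h
    & forall m, m < i -> vtx K (iter m.+1 q h) \in D.
Proof.
move=> hD; have q_inj : injective q by apply: inj_comp; apply: inv_inj.
have eq_qh : edge K h = q h by rewrite /= j_live.
have nthE m : m < #|H| -> nth h (traject q (q h) #|H|) m = iter m.+1 q h.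
  move=> lt_m; rewrite (set_nth_default (q h)) ?size_traject //.
  by rewrite nth_traject // iterSr.
rewrite /splice_exit eq_qh; set p := fun k => _; set s := traject _ _ _.
(* The orbit of h under q comes back to h, so it meets a remaining half-edge. *)
have has_s : has p s.
  apply/hasP; exists h => //; apply/trajectP; exists (order q h).-1.
    by rewrite prednK ?order_gt0 // max_card.
  by rewrite -iterSr prednK ?order_gt0 // iter_order.
have lt_find : find p s < #|H| by move: has_s; rewrite has_find size_traject.
split; first by have := nth_find h has_s.
exists (find p s); first exact: nthE.
move=> m lt_m; have := before_find h lt_m.
by rewrite nthE ?(ltn_trans lt_m) // => /negbFE.
Qed.

Lemma exit_live h : vtx K h \notin D -> vtx K (exit h) \notin D.
Proof. by case/exit_spec. Qed.

Lemma exit_connect h : vtx K h \notin D ->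
  connect (link (edge K) j) h (exit h).
Proof.
case/exit_spec=> _ [i -> _]; elim: i.+1 => [|n IH]; first exact: connect0.
by rewrite iterS; apply: connect_trans IH (connect_trans (link_j _ _ _) (link_e _ _ _)).
Qed.

(** The class of h is the path followed by [splice_exit], which meets remaining
    half-edges only at its two ends. *)
Lemma exit_uniq h k : vtx K h \notin D -> vtx K k \notin D ->
  connect (link (edge K) j) h k -> k = h \/ k = exit h.
Proof.
move=> hD kD; case/exit_spec: (hD) => xD [i xE lt_i].
have ejq m : edge K (iter m.+1 q h) = j (iter m q h) by rewrite iterS /= eK.
suff Pk : connect (link (edge K) j) h k -> exists2 m, m <= i.+1 &
    k = iter m q h \/ k = j (iter m q h).
  case/Pk => m le_m k_m.
  have {k_m} k_m : k = iter m q h.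
    by case: k_m => // kj; rewrite -(j_live kD) kj jK.
  case: m le_m k_m => [|m]; first by left.
  rewrite ltnS leq_eqVlt => /orP[/eqP->|/lt_i mD km]; first by rewrite -xE; right.
  by move: kD; rewrite km mD.
clear kD; move: k; apply: link_ind => [|_ [m le_m [|]->]|_ [m le_m [|]->]].
- by exists 0 => //; left.
- case: m le_m => [|m] le_m; first by exists 1 => //; left; rewrite /= j_live.
  by exists m; [exact: ltnW | right].
- move: le_m; rewrite leq_eqVlt => /orP[/eqP->|lt_m]; last by exists m.+1 => //; left.
  by exists i => //; right; rewrite -(ejq i) -xE j_live.
- by exists m => //; right.
by exists m => //; left; rewrite jK.
Qed.

End Exit.

Section SpliceIso.
Variable G : groupType.

(** A splice is determined by connectedness: a graph L is the splice as soon as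
    its vertices and half-edges are the remaining ones and the two half-edges of
    each of its edges are connected in K through deleted vertices, for no third
    remaining half-edge is connected to them. *)
Lemma splice_iso (V H V1 H1 : finType) (K : graph_data G V H)
    (L : graph_data G V1 H1) (D : {set V}) (j : H -> H)
    (fv : V1 -> V) (fh : H1 -> H) :
  involutive (edge K) -> involutive j ->
  (forall h, vtx K h \notin D -> j h = h) ->
  (forall h, vtx K (opp K h) = vtx K h) ->
  (forall h, edge L h != h) ->
  injective fv -> injective fh ->
  (forall w, fv w \notin D) ->
  (forall v, v \notin D -> exists w, fv w = v) ->
  (forall h, vtx K h \notin D -> exists k, fh k = h) ->
  (forall k, vtx K (fh k) = fv (vtx L k)) ->
  (forall k, connect (link (edge K) j) (fh k) (fh (edge L k))) ->
  (forall k, opp K (fh k) = fh (opp L k)) ->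
  (forall k, out K (fh k) = out L k) ->
  (forall w, label K (fv w) = label L w) ->
  circles L = circles K + splice_circles K D j ->
  iso L (splice K D j).
Proof.
move=> eK jK jl oV e0 fvI fhI fvD fvS fhS vE eE oE uE lE cE.
have fhD k : vtx K (fh k) \notin D by rewrite vE.
pose gv w : {v | v \notin D} := Sub (fv w) (fvD w).
pose gh k : {h | vtx K h \notin D} := Sub (fh k) (fhD k).
exists gv, gh; split.
  apply: inj_surj_bij => [x y /(congr1 val)/fvI //|[v vD]].
  by have [w wv] := fvS v vD; exists w; apply: val_inj.
split.
  apply: inj_surj_bij => [x y /(congr1 val)/fhI //|[h hD]].
  by have [w wv] := fhS h hD; exists w; apply: val_inj.
split; split=> // k; apply: val_inj; rewrite /= ?vE // val_insubd.
  rewrite (exit_live eK jK jl (fhD k)) /=.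
  by case: (exit_uniq eK jK jl (fhD k) (fhD _) (eE k)) => // /fhI/eqP; rewrite (negPf (e0 _)).
by rewrite oV fhD.
Qed.

End SpliceIso.

(** * Iterated splices *)

Section Splicing.
Variables (G : groupType) (V H : finType) (K : graph_data G V H).
Implicit Types (D : {set V}) (j : H -> H).

(** The joinings for which [splice K D j] is again a framed graph with a
    source-sink structure: an unjoined half-edge at a deleted vertex takes its
    whole edge with it, and joined half-edges have opposite directions. *)
Definition splicing D j : Prop :=
  [/\ involutive j, forall h, vtx K h \notin D -> j h = h,
      forall h, vtx K h \in D -> j h = h ->
        vtx K (edge K h) \in D /\ j (edge K h) = edge K h
    & forall h, j h != h -> out K (j h) = ~~ out K h].

Lemma splicing_ok D j : graph_ok K -> splicing D j -> graph_ok (splice K D j).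
Proof.
move=> [fK sK] [jK jl jd jf]; split; first exact: splice_framed.
exact: splice_source_sink.
Qed.

(** No new edge ends at an unjoined half-edge: going back from it, the previous
    half-edges would be unjoined as well. *)
Lemma splicing_dead D j h x : involutive (edge K) -> splicing D j ->
  vtx K h \notin D ->
  connect (link (edge K) j) h x -> vtx K x \in D -> j x <> x.
Proof.
move=> eK [jK jl jd jf] hD.
suff Px : connect (link (edge K) j) h x -> ~ (vtx K x \in D /\ j x = x).
  by move=> /Px Nx xD jx; apply: Nx.
move: x; apply: link_ind => [[]|x Nx [xD jx]|x Nx [xD jx]].
- by rewrite (negPf hD).
- by apply: Nx; have := jd _ xD jx; rewrite eK.
by apply: Nx; move: jx xD; rewrite jK => <-.
Qed.

Lemma val_edge_splice D j (h : {h | vtx K h \notin D}) :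
  graph_ok K -> splicing D j ->
  val (edge (splice K D j) h) = splice_exit K D j (val h).
Proof.
case=> -[eK _ _ _ _] _ [jK jl _ _].
by rewrite /= val_insubd (exit_live eK jK jl) //; case: h.
Qed.

Lemma val_opp_splice D j (h : {h | vtx K h \notin D}) :
  graph_ok K -> val (opp (splice K D j) h) = opp K (val h).
Proof.
case=> -[_ _ _ _ o0] _.
by rewrite /= val_insubd (o0 _).2; case: h => /= h ->.
Qed.

End Splicing.

Section Composition.
Variables (G : groupType) (V H : finType) (K : graph_data G V H).
Variables (D1 D : {set V}) (j1 j : H -> H).
Hypotheses (okK : graph_ok K) (spl1 : splicing K D1 j1).
Local Notation K1 := (splice K D1 j1).
Local Notation V1 := {v | v \notin D1}.
Local Notation H1 := {h | vtx K h \notin D1}.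
Variables (D2 : {set V1}) (j2 : H1 -> H1).
Hypothesis (D1D : D1 \subset D) (D2E : forall w : V1, (val w \in D) = (w \in D2)).
Hypothesis jD1 : forall h, vtx K h \in D1 -> j h = j1 h.
Hypothesis j_val : forall h : H1, j (val h) = val (j2 h).
Hypothesis j2K : involutive j2.

Let eK := ok_edgeK okK.
Let j1K : involutive j1. Proof. by case: spl1. Qed.
Let j1l h : vtx K h \notin D1 -> j1 h = h. Proof. by case: spl1 => _ + _ _; apply. Qed.
Let oV := ok_vtx_opp okK.

Lemma composite_inv : involutive j.
Proof.
move=> h; have [hD|hD] := boolP (vtx K h \in D1).
  rewrite (jD1 hD) jD1 ?j1K //; apply: contraLR hD => jD.
  by have := j1l jD; rewrite j1K => ->.
by rewrite -[h]/(val (Sub h hD : H1)) !j_val j2K.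
Qed.

Lemma composite_live : (forall h, vtx K1 h \notin D2 -> j2 h = h) ->
  forall h, vtx K h \notin D -> j h = h.
Proof.
move=> j2l h hD; have hD1 : vtx K h \notin D1.
  by apply: contra hD; apply: (subsetP D1D).
by rewrite -[h]/(val (Sub h hD1 : H1)) j_val j2l // -D2E.
Qed.

Let e1P (h : H1) :
  connect (link (edge K) j1) (val h) (val (edge K1 h)).
Proof.
by rewrite val_edge_splice //; apply: (exit_connect eK j1K j1l); apply: valP h.
Qed.

Let surj x : ~~ (vtx K x \in D1) -> exists h : H1, val h = x.
Proof. by move=> xD; exists (Sub x xD). Qed.

Lemma splice_connect (h k : H1) :
  connect (link (edge K1) j2) h k = connect (link (edge K) j) (val h) (val k).
Proof.
apply: (@connect_composite _ _ val _ j1 _ (fun x => vtx K x \in D1)) => //.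
move=> x y /(exit_uniq eK j1K j1l (valP x) (valP y)).
by case=> [/val_inj->|]; [left|rewrite -val_edge_splice // => /val_inj->; right].
Qed.

Lemma splice_circles_splice :
  splice_circles K D j = splice_circles K D1 j1 + splice_circles K1 D2 j2.
Proof.
have [ok1 _] := splicing_ok okK spl1.
have e1K : involutive (edge K1) by case: ok1.
apply: (@wire_loops_composite _ _ val (edge K) j1 j
  (fun x => vtx K x \in D1) (fun x => vtx K x \in D)) => //.
- exact: val_inj.
- by move=> [x xD]; apply: negbTE.
- move=> x y /(exit_uniq eK j1K j1l (valP x) (valP y)).
  by case=> [/val_inj->|]; [left|rewrite -val_edge_splice // => /val_inj->; right].
- exact: composite_inv.
- by move=> x; apply: (subsetP D1D).
- by move=> x; rewrite -D2E.
by move=> h x xD hx; apply: splicing_dead hx xD => //; apply: valP h.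
Qed.

(** Deleting D1 and then the rest of D is deleting D at once, with the joining that
    agrees with the first one on D1 and with the second one elsewhere. *)
Lemma splice_splice : splicing K1 D2 j2 ->
  iso (splice K1 D2 j2) (splice K D j).
Proof.
move=> spl2; have ok1 := splicing_ok okK spl1.
have [[_ e0 _ _ _] _] := splicing_ok ok1 spl2.
have e1K : involutive (edge K1) by case: ok1 => -[].
have [_ j2l _ _] := spl2.
apply: (@splice_iso _ _ _ _ _ K _ D j (val \o val) (val \o val)) => //.
- exact: composite_inv.
- exact: composite_live.
- by apply: inj_comp; apply: val_inj.
- by apply: inj_comp; apply: val_inj.
- by move=> [w wD]; rewrite /= D2E.
- move=> v vD; have vD1 : v \notin D1 by apply: contra vD; apply: (subsetP D1D).
  have wD2 : (Sub v vD1 : V1) \notin D2 by rewrite -D2E.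
  by exists (Sub (Sub v vD1) wD2).
- move=> h hD; have hD1 : vtx K h \notin D1 by apply: contra hD; apply: (subsetP D1D).
  have wD2 : vtx K1 (Sub h hD1) \notin D2 by rewrite -D2E.
  by exists (Sub (Sub h hD1) wD2).
- move=> k; rewrite /= -splice_connect /=.
  have kD := valP k; rewrite val_insubd (exit_live e1K j2K j2l kD).
  exact: exit_connect.
- by move=> k; rewrite -(val_opp_splice j1 _ okK) -(val_opp_splice j2 _ ok1).
by rewrite splice_circles_splice addnA.
Qed.

End Composition.

(** * The bracket of an arbitrary G-graph *)

Section KnotValue.
Variable G : groupType.
Local Open Scope ring_scope.

Definition iso_by (V H V' H' : finType) (K : graph_data G V H)
    (K' : graph_data G V' H') (fv : V -> V') (fh : H -> H') : Prop :=
  bijective fv /\ bijective fh /\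
    [/\ forall h, vtx K' (fh h) = fv (vtx K h),
        forall h, edge K' (fh h) = fh (edge K h)
      & forall h, opp K' (fh h) = fh (opp K h)] /\
    [/\ forall h, out K' (fh h) = out K h,
        forall v, label K' (fv v) = label K v
      & circles K' = circles K].

Lemma iso_splice (V H V' H' : finType) (K : graph_data G V H)
    (K' : graph_data G V' H') fv fh (D : {set V}) j (D' : {set V'}) j' :
  graph_ok K -> iso_by K K' fv fh -> splicing K D j ->
  (forall v, (fv v \in D') = (v \in D)) ->
  (forall h, j' (fh h) = fh (j h)) ->
  iso (splice K D j) (splice K' D' j').
Proof.
move=> okK KK' spl DE jE; have ok' : graph_ok K'.
  by apply: iso_ok okK; exists fv, fh.
have [[_ e0 _ _ _] _] := splicing_ok okK spl.
have [[eK _ _ _ _] _] := okK; have [[eK' _ _ _ o'] _] := ok'.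
have [jK jl _ _] := spl.
case: KK' => [bv [bh [[vE eE oE] [uE lE cE]]]].
have [gv gvK fvK] := bv; have [gh ghK fhK] := bh.
have jK' : involutive j' by move=> h; rewrite -[h]fhK !jE jK.
apply: (@splice_iso _ _ _ _ _ K' _ D' j' (fv \o val) (fh \o val)) => //.
- by move=> h; rewrite -[h]fhK vE DE => hD; rewrite jE jl.
- by move=> h; case: (o' h).
- by apply: inj_comp; [exact: can_inj gvK | exact: val_inj].
- by apply: inj_comp; [exact: can_inj ghK | exact: val_inj].
- by move=> w; rewrite /= DE; apply: valP w.
- by move=> v; rewrite -{1}[v]fvK DE => vD; exists (Sub (gv v) vD); rewrite /= fvK.
- by move=> h; rewrite -{1}[h]fhK vE DE => hD; exists (Sub (gh h) hD); rewrite /= fhK.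
- by move=> k; rewrite /= vE.
- move=> k.
  suff: connect (link (edge K') j') (fh (val k)) (fh (splice_exit K D j (val k))).
    by rewrite -(val_edge_splice k okK spl).
  move: (exit_connect eK jK jl (valP k)); move: (splice_exit _ _ _ _).
  apply: link_ind => [|x kx|x kx]; first exact: connect0.
    by rewrite -eE; apply: connect_trans kx (link_e _ _ _).
  by rewrite -jE; apply: connect_trans kx (link_j _ _ _).
- by move=> k; rewrite [LHS]oE -(val_opp_splice j k okK).
- by move=> k; rewrite /= uE.
- by move=> w; rewrite /= lE.
rewrite /= cE; congr (_ + _)%N.
by apply: (wire_loops_bij bh) => // h; rewrite /= vE DE.
Qed.

Lemma ord_iso (V H : finType) (K : graph_data G V H) : iso K (ord_data K).
Proof.
have rank_bij (T : finType) : bijective (@enum_rank T).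
  exact: (Bijective (@enum_rankK T) (@enum_valK T)).
exists enum_rank, enum_rank; split; first exact: rank_bij.
split; first exact: rank_bij.
by split; split=> // h; rewrite /= enum_rankK.
Qed.

Definition nonunit_data (V H : finType) (K : graph_data G V H) :=
  forall v, label K v <> 1%g.

Lemma iso_nonunit (V H V' H' : finType) (K : graph_data G V H)
    (K' : graph_data G V' H') : iso K K' -> nonunit_data K -> nonunit_data K'.
Proof.
case=> fv [fh [[gv _ fvK] [_ [_ [_ l _]]]]] nK v.
by rewrite -[v]fvK l; apply: nK.
Qed.

Lemma nonunit_repr (V H : finType) (K : graph_data G V H) :
  graph_ok K -> nonunit_data K -> exists N : nonunit_ggraph G, iso K (sval N).
Proof.
move=> [fK sK] nK.
have nN : nonunit (ord_ggraph fK sK) by apply: (iso_nonunit (ord_iso K)).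
by exists (exist _ _ nN); apply: ord_iso.
Qed.

(** The summand of the bracket: for a G-graph K its class if K has one component
    and no vertex labeled by the unit, and 0 otherwise.  Passing through an isomorphic
    graph on ordinals makes it invariant under isomorphism and defined for every
    carrier, such as the subtypes produced by splices. *)
Definition knot_val (V H : finType) (K : graph_data G V H) : S_space G :=
  if pselect (exists N : nonunit_ggraph G, iso K (sval N) /\ ncomp (sval N) = 1%N)
  is left exN then << class_of (projT1 (cid exN)) >> else 0.

Lemma class_of_eq (N N' : nonunit_ggraph G) :
  nonunit_equiv N N' -> class_of N = class_of N'.
Proof. by move=> NN'; apply/eqmodP/asboolP. Qed.

Lemma knot_valE (V H : finType) (K : graph_data G V H) (N : nonunit_ggraph G) :
  iso K (sval N) -> ncomp (sval N) = 1%N -> knot_val K = << class_of N >>.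
Proof.
move=> KN N1; rewrite /knot_val; case: pselect => [exN|[]]; last by exists N.
case: cid => /= N' [KN' _]; congr (<< _ >>); apply: class_of_eq.
by apply: rst_step; apply: Or31; apply: iso_trans (iso_sym KN') KN.
Qed.

Lemma knot_val_iso (V H V' H' : finType) (K : graph_data G V H)
    (K' : graph_data G V' H') : iso K K' -> knot_val K = knot_val K'.
Proof.
move=> KK'; have K'K := iso_sym KK'; rewrite {1}/knot_val; case: pselect => [exN|nN].
  case: cid => /= N [KN N1]; symmetry; apply: knot_valE => //.
  exact: iso_trans K'K KN.
rewrite /knot_val; case: pselect => // -[N [KN N1]]; case: nN.
by exists N; split=> //; apply: iso_trans KN.
Qed.

Lemma knot_val0 (V H : finType) (K : graph_data G V H) :
  graph_ok K -> ncomp K <> 1%N -> knot_val K = 0.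
Proof.
move=> okK K1; rewrite /knot_val; case: pselect => // -[N [KN N1]]; case: K1.
by rewrite (iso_ncomp KN okK).
Qed.

End KnotValue.

Section Bracket.
Variable G : groupType.
Local Open Scope ring_scope.

Section Ways.
Variables (V H : finType) (K : graph_data G V H).

(** For U the set of unit vertices this is a way of smoothing; other sets U are
    needed to smooth some of these vertices first. *)
Definition way (U : {set V}) (J : {ffun H -> H}) : bool :=
  [forall h, if vtx K h \in U then adjacent K h (J h) && (J (J h) == h)
             else J h == h].

Definition units : {set V} := [set v | label K v == 1%g].

Definition bracket : S_space G :=
  \sum_(J | way units J) knot_val (splice K units J).

Lemma way_splicing U J : graph_ok K -> way U J -> splicing K U J.
Proof.
move=> [_ [_ sK]] /forallP WJ; split=> [h|h hU|h hU Jh|h Jh].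
- by have := WJ h; case: ifP => _; [case/andP=> _ /eqP | move/eqP=> Jh; rewrite !Jh].
- by have := WJ h; rewrite (negPf hU) => /eqP.
- by have := WJ h; rewrite hU Jh /adjacent !eqxx.
have := WJ h; rewrite (negPf Jh); case: ifP => // _.
case/andP=> /and3P[/eqP /sK + n1 n2] _; rewrite (negPf n1) (negPf n2).
by case: (out K h); case: (out K _).
Qed.

End Ways.

(** [bracket] sums over functions instead of a subtype, and makes sense on any
    carriers; its summands with several components vanish. *)
Lemma unit_bracketE (K : ggraph G) : unit_bracket K = bracket (gdata K).
Proof.
have okK : graph_ok K by split; [exact: gframed | exact: gsource_sink].
rewrite /unit_bracket big_mkcond /bracket.
rewrite (reindex_omap (val : smoothing K -> _) insub) /=; last first.
  by move=> J WJ; rewrite insubT.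
apply: eq_big => [[J WJ]|s _] /=.
  by rewrite insubT eqxx andbT; apply/esym.
have sN : iso (splice K (units K) (val s)) (sval (smooth s)) by apply: ord_iso.
case: eqP => s1; first by rewrite (knot_valE sN).
have ok_s : graph_ok (splice K (units K) (val s)).
  by split; [exact: smooth_framed | exact: smooth_source_sink].
by rewrite knot_val0 // (iso_ncomp sN).
Qed.

Lemma bracket_iso (V H V' H' : finType) (K : graph_data G V H)
    (K' : graph_data G V' H') : graph_ok K -> iso K K' -> bracket K = bracket K'.
Proof.
move=> okK [fv [fh KK']]; have [bv [bh [[vE eE oE] [uE lE cE]]]] := KK'.
have [gv gvK fvK] := bv; have [gh ghK fhK] := bh.
have fI := can_inj ghK; have fvI := can_inj gvK.
pose f (J : {ffun H -> H}) : {ffun H' -> H'} := [ffun h => fh (J (gh h))].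
pose f' (J : {ffun H' -> H'}) : {ffun H -> H} := [ffun h => gh (J (fh h))].
have fK : cancel f f' by move=> J; apply/ffunP => h; rewrite !ffunE !ghK.
have f'K : cancel f' f by move=> J; apply/ffunP => h; rewrite !ffunE !fhK.
rewrite [RHS](reindex f) /=; last by apply: onW_bij; exists f'.
have UE v : (fv v \in units K') = (v \in units K) by rewrite !inE lE.
have fE J h : f J (fh h) = fh (J h) by rewrite ffunE ghK.
have WE J : way K (units K) J = way K' (units K') (f J).
  apply/forallP/forallP => WJ h.
    have := WJ (gh h).
    by rewrite -[h]fhK !fE vE UE /adjacent !vE oE !(inj_eq fI) (inj_eq fvI) !ghK.
  have := WJ (fh h).
  by rewrite !fE vE UE /adjacent !vE oE !(inj_eq fI) (inj_eq fvI).
apply: eq_big => [J|J WJ]; first exact: WE.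
apply: knot_val_iso; apply: iso_splice KK' _ UE _ => //.
exact: way_splicing.
Qed.

End Bracket.

(** * The skein relation *)

Section Skein.
Variables (G : groupType) (V H : finType) (K : graph_data G V H).
Local Open Scope ring_scope.

(** The joining of an iterated splice: j on the vertices deleted first, J
    elsewhere. *)
Definition glue (D : {set V}) (j J : H -> H) (h : H) : H :=
  if vtx K h \in D then j h else J h.

(** The smoothings of a splice are splices of K itself, indexed by the ways of
    smoothing the unit vertices that remain. *)
Lemma bracket_splice (D : {set V}) (j : H -> H) :
  graph_ok K -> splicing K D j ->
  bracket (splice K D j) = \sum_(J | way K (units K :\: D) J)
    knot_val (splice K (D :|: units K) (glue D j J)).
Proof.
move=> okK spl; set K1 := splice K D j.
have ok1 : graph_ok K1 by apply: splicing_ok.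
have [[_ _ _ _ o0] _] := okK.
pose H1 := {h | vtx K h \notin D}.
pose f (J : {ffun H -> H}) : {ffun H1 -> H1} := [ffun h => insubd h (J (val h))].
pose g (J : {ffun H1 -> H1}) : {ffun H -> H} :=
  [ffun h => if insub h is Some k then val (J k) else h].
have gE J (h : H1) : g J (val h) = val (J h) by rewrite ffunE valK.
have gD J h : vtx K h \in D -> g J h = h.
  by move=> hD; rewrite ffunE insubN // hD.
have UE (v : {v | v \notin D}) : (v \in units K1) = (val v \in units K :\: D).
  by rewrite !inE (valP v).
have fE (J : {ffun H -> H}) (h : H1) : vtx K (J (val h)) \notin D -> val (f J h) = J (val h).
  by move=> JD; rewrite ffunE val_insubd JD.
have adjE (h k : H1) : adjacent K1 h k = adjacent K (val h) (val k).
  by rewrite /adjacent -!val_eqE (val_opp_splice j h okK).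
rewrite /bracket (reindex_onto f g) /=; last first.
  move=> J _; apply/ffunP => h; apply: val_inj.
  by rewrite fE gE //; apply: valP (J h).
have wayP J : way K1 (units K1) (f J) && (g (f J) == J) = way K (units K :\: D) J.
  apply/andP/idP => [[/forallP WJ /eqP gfJ]|/forallP WJ].
    apply/forallP => h; have [hD|hD] := boolP (vtx K h \in D).
      by rewrite in_setD hD /= -gfJ gD.
    have := WJ (Sub h hD); rewrite UE adjE -!val_eqE.
    rewrite -!gE gfJ /=; case: ifP => //.
  have JD (h : H1) : vtx K (J (val h)) \notin D.
    have := WJ (val h); case: ifP => [_ /andP[/and3P[/eqP <-]]|_ /eqP->] //;
      by rewrite (valP h).
  split.
    apply/forallP => h; have := WJ (val h); rewrite UE adjE -!val_eqE.
    by rewrite !fE ?JD // -fE ?JD //.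
  apply/eqP/ffunP => h; have [hD|hD] := boolP (vtx K h \in D).
    by rewrite gD //; have := WJ h; rewrite in_setD hD => /eqP.
  by rewrite -[h]/(val (Sub h hD : H1)) gE fE ?JD.
apply: eq_big => // J; rewrite wayP => WJ; apply: knot_val_iso.
have WfJ : way K1 (units K1) (f J) by move: WJ; rewrite -wayP => /andP[].
apply: splice_splice => //.
- by apply/subsetP => v; rewrite inE => ->.
- by move=> w; rewrite in_setU UE in_setD (negPf (valP w)).
- by move=> h hD; rewrite /glue hD.
- move=> h; rewrite /glue (negPf (valP h)) -gE.
  by move: WJ; rewrite -wayP => /andP[_ /eqP->].
- by have [] := way_splicing ok1 WfJ.
exact: way_splicing.
Qed.

(** At a vertex, two half-edges in the same direction are opposite, so two
    adjacent half-edges and their opposites exhaust the vertex. *)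
Lemma at_vertex h k x : source_sink K -> adjacent K h k -> vtx K x = vtx K h ->
  x \in [:: h; opp K h; k; opp K k].
Proof.
case=> _ sK /and3P[/eqP hk n1 n2] xh; rewrite !inE.
have := sK _ _ hk; rewrite (negPf n1) (negPf n2) /= => nout.
have := sK _ _ (esym xh); have := sK _ _ (etrans (esym hk) (esym xh)).
case: (x == h); case: (x == opp K h) => //=.
case: (x == k); case: (x == opp K k) => //=.
by move: nout; case: (out K h); case: (out K k); case: (out K x).
Qed.

(** The smoothing which joins h to k, and hence opp h to opp k. *)
Definition corner (h k : H) : H -> H := tperm h k \o tperm (opp K h) (opp K k).

Lemma adjacent_sym h k : adjacent K h k -> framed_4graph K -> adjacent K k h.
Proof.
case/and3P=> [/eqP hk n1 n2] [_ _ _ oK _].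
by rewrite /adjacent hk eqxx eq_sym n1 -(inv_eq oK) eq_sym.
Qed.

Lemma adjacent_opp h k : adjacent K h k -> framed_4graph K -> adjacent K h (opp K k).
Proof.
case/and3P=> [/eqP hk n1 n2] [_ _ _ oK o0].
by rewrite /adjacent hk (o0 k).2 eqxx (inv_eq oK) n2 (inj_eq (inv_inj oK)).
Qed.

Lemma cornerE h k : framed_4graph K -> adjacent K h k ->
  [/\ corner h k h = k, corner h k k = h,
      corner h k (opp K h) = opp K k, corner h k (opp K k) = opp K h
    & forall x, x \notin [:: h; opp K h; k; opp K k] -> corner h k x = x].
Proof.
move=> [_ _ _ oK o0] /and3P[_ n1 n2].
have oh := (o0 h).1; have ok := (o0 k).1.
have n3 : h != opp K k by rewrite -(inv_eq oK) eq_sym.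
have n4 : opp K h != opp K k by rewrite (inj_eq (inv_inj oK)) eq_sym.
rewrite /corner /=; split.
- by rewrite (tpermD (z := h)) ?tpermL // eq_sym.
- by rewrite (tpermD (z := k)) ?tpermR // eq_sym.
- by rewrite tpermL tpermD // eq_sym.
- by rewrite tpermR tpermD // eq_sym.
move=> x; rewrite !inE !negb_or => /and4P[a b c d].
by rewrite !tpermD // eq_sym.
Qed.

Lemma corner_way h k (U : {set V}) : graph_ok K -> adjacent K h k ->
  U = [set vtx K h] -> way K U [ffun x => corner h k x].
Proof.
move=> [fK sK] hk ->; have [c1 c2 c3 c4 c5] := cornerE fK hk.
have [_ _ _ oK o0] := fK; have kh := adjacent_sym hk fK.
have oo := adjacent_opp (adjacent_sym (adjacent_opp hk fK) fK) fK.
have [/eqP vhk _ _] := and3P hk.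
apply/forallP => x; rewrite !ffunE inE; case: eqP => [xv|xv].
  have := at_vertex sK hk xv; rewrite !inE => /or4P[]/eqP->.
  - by rewrite c1 c2 eqxx hk.
  - by rewrite c3 c4 eqxx (adjacent_sym oo fK).
  - by rewrite c2 c1 eqxx kh.
  by rewrite c4 c3 eqxx oo.
rewrite c5 // !inE; apply/negP => /or4P[]/eqP ex; apply: xv; rewrite ex //.
- exact: (o0 h).2.
by rewrite (o0 k).2.
Qed.

Lemma corner_splicing h k : graph_ok K -> adjacent K h k ->
  splicing K [set vtx K h] (corner h k).
Proof.
move=> okK hk; have := way_splicing okK (corner_way okK hk erefl).
suff -> : ([ffun x => corner h k x] : H -> H) = corner h k by [].
by apply/funext => x; rewrite ffunE.
Qed.

(** A way of smoothing all unit vertices that joins h to k is determined at the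
    vertex of h, so it is given by its restriction to the other vertices. *)
Lemma skein_half h k : graph_ok K -> adjacent K h k -> vtx K h \in units K ->
  \sum_(J | way K (units K) J && (J h == k)) knot_val (splice K (units K) J) =
  bracket (splice K [set vtx K h] (corner h k)).
Proof.
move=> okK hk hU; rewrite bracket_splice //; last exact: corner_splicing.
set v := vtx K h; have [fK sK] := okK; have [_ _ _ oK o0] := fK.
have [c1 c2 c3 c4 _] := cornerE fK hk.
(* A way on the other unit vertices is the identity at v, and is completed at v by
   the corner. *)
pose f (J : {ffun H -> H}) : {ffun H -> H} :=
  [ffun x => glue [set v] (corner h k) J x].
pose g (J : {ffun H -> H}) : {ffun H -> H} := [ffun x => glue [set v] id J x].
have /forallP Wc := corner_way okK hk erefl.
have Jcorner J x : way K (units K) J -> J h = k -> vtx K x = v -> J x = corner h k x.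
  move=> WJ Jh xv; have [JK _ _ _] := way_splicing okK WJ.
  have Jk : J k = h by rewrite -Jh JK.
  have vk : vtx K k = v by case/and3P: hk => /eqP.
  have adjJ y : vtx K y = v -> adjacent K y (J y).
    by move=> yv; have := forallP WJ y; rewrite yv hU => /andP[].
  have Joh : J (opp K h) = opp K k.
    have oh : vtx K (opp K h) = v by rewrite (o0 h).2.
    have /and3P[/eqP a1 a2 a3] := adjJ _ oh.
    have := at_vertex sK hk (etrans (esym a1) oh); rewrite !inE.
    move: a3; rewrite oK (negPf a2) => /negPf-> /=.
    case/orP=> /eqP // Jk'; have := (o0 h).1.
    by rewrite -[opp K h]JK Jk' Jk eqxx.
  have := at_vertex sK hk xv; rewrite !inE => /or4P[]/eqP->.
  - by rewrite c1.
  - by rewrite c3.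
  - by rewrite c2.
  by rewrite c4 -Joh JK.
rewrite (reindex_onto f g) /=; last first.
  move=> J /andP[WJ /eqP Jh]; apply/ffunP => x; rewrite !ffunE /glue inE.
  by case: eqP => [xv|xv]; [rewrite Jcorner | rewrite ffunE /glue inE; case: eqP].
have UvU : [set v] :|: units K = units K by apply/setUidPr; rewrite sub1set.
rewrite UvU; apply: eq_big => [J|J _]; last first.
  by congr (knot_val (splice K _ _)); apply/funext => x; rewrite ffunE.
apply/idP/idP => [/andP[/andP[/forallP WJ _] /eqP gJ]|/forallP WJ].
  apply/forallP => x; rewrite in_setD inE.
  have := WJ x; rewrite !ffunE /glue !inE -/v.
  case: (vtx K x =P v) => xv /=.
    by move=> _; move/ffunP/(_ x): gJ; rewrite !ffunE /glue inE xv eqxx => <-.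
  case: ifP => // _.
  by case: (vtx K (J x) =P v) => [Jv /andP[/and3P[/eqP vv]]|//]; rewrite vv in xv.
have lv : label K v == 1%g by move: hU; rewrite inE.
rewrite -andbA; apply/and3P; split.
- apply/forallP => x; have := WJ x; have := Wc x.
  rewrite in_setD !inE !ffunE /glue !inE -/v.
  case: (vtx K x =P v) => [xv|xv] /=.
    rewrite xv lv => /andP[/and3P[/eqP vc n1 n2] cc] _.
    by rewrite -vc xv eqxx /adjacent vc eqxx n1 n2.
  case: ifP => // _ _ /andP[/and3P[/eqP vJ n1 n2] JJ].
  by rewrite -vJ (introF eqP xv) /adjacent vJ eqxx n1 n2.
- by rewrite ffunE /glue inE eqxx c1.
apply/eqP/ffunP => x; rewrite !ffunE /glue !inE; case: eqP => xv.
  by have := WJ x; rewrite in_setD inE xv eqxx => /eqP.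
by rewrite ffunE /glue inE; case: eqP.
Qed.

(** The half-edge h is joined to one of the two half-edges adjacent to it. *)
Lemma skein h k : graph_ok K -> adjacent K h k -> label K (vtx K h) = 1%g ->
  bracket K = bracket (splice K [set vtx K h] (corner h k))
            + bracket (splice K [set vtx K h] (corner h (opp K k))).
Proof.
move=> okK hk h1; have hU : vtx K h \in units K by rewrite inE h1.
have [fK sK] := okK; have hk' := adjacent_opp hk fK.
rewrite -skein_half // -skein_half // /bracket (bigID (fun J : {ffun H -> H} => J h == k)) /=.
congr (_ + _); apply: eq_bigl => J; apply: andb_id2l => /forallP WJ.
have := WJ h; rewrite hU => /andP[/and3P[/eqP vJ /negPf n1 /negPf n2] _].
have := at_vertex sK hk (esym vJ); rewrite !inE n1 n2 /=.
case/orP=> /eqP->; rewrite eqxx; first by rewrite eq_sym; case: fK => _ _ _ _ /(_ k)[/negPf->].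
by case: fK => _ _ _ _ /(_ k)[->].
Qed.

End Skein.

Lemma adjacent_uniq (G : groupType) (V H : finType) (K : graph_data G V H) h k :
  graph_ok K -> adjacent K h k -> uniq [:: h; k; opp K h; opp K k].
Proof.
case=> -[_ _ _ oK o0] _ /and3P[_ n1 n2]; rewrite /= !inE !negb_or.
have n3 : h != opp K k by rewrite -(inv_eq oK) eq_sym.
rewrite (inj_eq (inv_inj oK)) [h == opp K h]eq_sym [k == opp K k]eq_sym.
by rewrite [h == k]eq_sym n1 n2 n3 !(proj1 (o0 _)).
Qed.

(** * Bypasses and component counts of splices *)

Section Local.
Variables (G : groupType) (V H : finType) (K : graph_data G V H).
Hypothesis okK : graph_ok K.

Let eK := ok_edgeK okK.
Let e0 := ok_edge_neq okK.
Let oK := ok_oppK okK.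
Let o0 := ok_opp_neq okK.
Let oV := ok_vtx_opp okK.

(** Only deleted half-edges are bypassed, so that the new edges are the same. *)
Lemma splice_bypass (D : {set V}) (j : H -> H) (x : H) :
  involutive j -> (forall h, vtx K h \notin D -> j h = h) ->
  graph_ok (splice K D j) -> vtx K x \in D -> vtx K (edge K x) \in D ->
  j x != edge K x ->
  iso (splice K D j) (splice K D (bypass (edge K) j x)).
Proof.
move=> jK jl [[_ es0 _ _ _] _] xD yD jx.
have b_inv := bypass_inv (e := edge K) jK (e0 x) jx.
apply: (@splice_iso _ _ _ _ _ K _ D _ val val) => //.
- exact: (@bypass_live _ (edge K) j (fun h => vtx K h \in D)).
- exact: val_inj.
- exact: val_inj.
- by move=> w; apply: valP w.
- by move=> v vD; exists (Sub v vD).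
- by move=> h hD; exists (Sub h hD).
- move=> k; have kD := valP k.
  have nx z : vtx K z \notin D -> (z != x) && (z != edge K x).
    by move=> zD; apply/andP; split; apply: contraNneq zD => ->.
  have eD : vtx K (splice_exit K D j (val k)) \notin D by apply: exit_live.
  have /andP[k1 k2] := nx _ kD; have /andP[l1 l2] := nx _ eD.
  rewrite /= val_insubd eD connect_bypass //; exact: exit_connect.
- by move=> k; rewrite -(val_opp_splice j k okK).
congr (_ + _); rewrite /splice /= /splice_circles -!/(wire_loops _ _ _).
exact: esym (wire_loops_bypass eK jK (e0 x) jx _ _).
Qed.

(** The components of the splice are the circles obtained by joining, after the
    splice, every half-edge to its opposite. *)
Lemma ncomp_splice (D : {set V}) (j : H -> H) : splicing K D j ->
  ncomp (splice K D j) = circles K +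
    wire_loops (edge K) (fun h => if vtx K h \in D then j h else opp K h) predT.
Proof.
move=> spl; have ok1 := splicing_ok okK spl.
rewrite ncomp_wire_loops; last by case: ok1.
rewrite /= -addnA; congr (_ + _).
pose jo h := if vtx K h \in D then j h else opp K h; rewrite -/jo.
have := @splice_circles_splice _ _ _ K D setT j jo okK spl setT (opp (splice K D j)).
rewrite /splice_circles => E; symmetry.
transitivity (wire_loops (edge K) jo (fun h => vtx K h \in [set: V])).
  by apply: eq_wire_loops => h //; rewrite in_setT.
rewrite [LHS]E //.
- by congr (_ + _); apply: eq_wire_loops => h //; rewrite in_setT.
- by move=> w; rewrite !inE.
- by move=> h hD; rewrite /jo hD.
- by move=> h; rewrite /jo (negPf (valP h)) (val_opp_splice _ _ okK).
by case: ok1 => -[].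
Qed.

Lemma exit_edge (D : {set V}) (j : H -> H) h : splicing K D j ->
  vtx K h \notin D -> vtx K (edge K h) \notin D ->
  splice_exit K D j h = edge K h.
Proof.
move=> [jK jl _ _] hD ehD.
have [/eqP|->//] := exit_uniq eK jK jl hD ehD (link_e _ _ _).
by rewrite (negPf (e0 h)).
Qed.

(** * The first move *)

Lemma r1_splicing (l : H) : r1_fragment K l ->
  splicing K [set vtx K l] (tperm (opp K l) (opp K (edge K l))).
Proof.
case/andP=> adj _; have [fK sK] := okK; have [Ke Ks] := sK.
set y := edge K l in adj *; have [/eqP vly n1 n2] := and3P adj.
have out_opp x : out K (opp K x) = out K x.
  by have := Ks x (opp K x) (esym (oV x)); rewrite eqxx orbT => /eqP.
have vy' : vtx K (opp K y) = vtx K l by rewrite oV.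
have n3 : opp K l != opp K y by rewrite (inj_eq (inv_inj oK)) eq_sym.
split; first exact: tpermK.
- move=> h; rewrite inE => hv; rewrite tpermD //; apply: contra_neq hv => <-.
    by rewrite oV.
  by rewrite vy'.
- move=> h; rewrite inE => /eqP hv; have := at_vertex sK adj hv; rewrite !inE.
  have [l1 y1] : opp K l != l /\ opp K y != y by [].
  have n4 : opp K y != l by rewrite -(inv_eq oK) eq_sym in n2 *.
  have jly : tperm (opp K l) (opp K y) l = l /\ tperm (opp K l) (opp K y) y = y.
    by rewrite !tpermD // eq_sym.
  case/or4P=> /eqP->; rewrite -/y ?vly ?eqxx.
  - by case: jly.
  - by rewrite tpermL => E; rewrite E eqxx in n3.
  - by rewrite eK vly; case: jly.
  by rewrite tpermR => E; rewrite E eqxx in n3.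
move=> h; case: tpermP => [->|->|]; rewrite ?eqxx // !out_opp Ke ?negbK //.
Qed.

(** Joining the two ends of the loop gives a circle disjoint from the half-edge
    opposite to l, so that these smoothings have at least two components.  In the
    other smoothing at the vertex the loop lies on a path between the two
    remaining half-edges, and bypassing it gives the result of the move. *)
Lemma bracket_r1 (l : H) : r1_fragment K l -> bracket K = bracket (r1_result K l).
Proof.
case/andP=> adj /eqP l1; have [fK sK] := okK; set y := edge K l in adj *.
have adj' := adjacent_opp adj fK.
rewrite (skein okK adj l1) -skein_half //; last by rewrite inE l1.
rewrite big1 ?add0r => [|J /andP[WJ /eqP Jl]].
  have spl := corner_splicing okK adj'; have ok1 := splicing_ok okK spl.
  have [c1 c2 c3 c4 c5] := cornerE fK adj'.
  have [/eqP vly n1 n2] := and3P adj.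
  have [jK jl _ _] := spl.
  have [a1 a2] : opp K l != l /\ opp K y != y by [].
  have a3 : opp K l != opp K y by rewrite (inj_eq (inv_inj oK)) eq_sym.
  have a4 : l != opp K y by rewrite -(inv_eq oK) eq_sym.
  apply: bracket_iso => //.
  suff -> : r1_result K l = splice K [set vtx K l] (bypass (edge K) (corner K l (opp K y)) l).
    apply: splice_bypass => //; rewrite ?inE -/y ?c1 //; by rewrite -vly.
  congr (splice K _ _); apply/funext => h; rewrite /bypass -/y.
  have [->|hl] := eqVneq h l; first by rewrite tpermD // eq_sym.
  have [->|hy] := eqVneq h y; first by rewrite tpermD // eq_sym.
  rewrite oK in c4.
  have [->|hl'] := eqVneq h (opp K l); first by rewrite c3 oK c1 tpermL; eq_simp.
  have [->|hy'] := eqVneq h (opp K y).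
    by rewrite c2 c4 tpermR; eq_simp.
  rewrite tpermD 1?eq_sym // c5 ?inE; eq_simp => //.
  by rewrite oK; eq_simp.
have spl := way_splicing okK WJ; have [jK _ _ _] := spl.
apply: knot_val0; first exact: splicing_ok.
rewrite ncomp_splice //.
pose jo h := if vtx K h \in units K then J h else opp K h; rewrite -/jo => E.
have WJ' h := forallP WJ h.
have jo_gt1 : 1 < wire_loops (edge K) jo predT.
  have joK : involutive jo.
    move=> h; rewrite /jo; case: (boolP (vtx K h \in units K)) => hU.
      have := WJ' h; rewrite hU => /andP[/and3P[/eqP vJ _ _] _].
      by rewrite -vJ hU jK.
    by rewrite oV (negPf hU) oK.
  apply: (@wire_loops_gt1 _ _ _ l (opp K l)) => // [h|].
    rewrite /jo; case: ifP => // hU.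
    by have := WJ' h; rewrite hU => /andP[/and3P[_ ? _] _].
  have joU h : vtx K h = vtx K l -> jo h = J h by move=> hl; rewrite /jo hl inE l1 eqxx.
  have [/eqP vly n1 n2] := and3P adj.
  suff Pl z : connect (link (edge K) jo) l z -> z \in [:: l; y].
    apply/negP => /Pl; rewrite !inE (negPf (o0 l)) /= -[y]oK (inj_eq (inv_inj oK)).
    by rewrite -(inv_eq oK) eq_sym (negPf n2).
  move: z; apply: link_ind => [|z|z]; rewrite !inE ?eqxx // => /orP[]/eqP->.
  - by rewrite eqxx orbT.
  - by rewrite /y eK eqxx.
  - by rewrite joU // Jl eqxx orbT.
  by rewrite joU ?vly // -Jl jK eqxx.
by move: jo_gt1; rewrite -E ltnNge leq_addl.
Qed.

End Local.

(** * The second move *)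

Section R2.
Variables (G : groupType) (V H : finType) (K : graph_data G V H) (l m : H).
Hypotheses (okK : graph_ok K) (frag : r2_fragment K l m).

Let eK := ok_edgeK okK.
Let e0 := ok_edge_neq okK.
Let oK := ok_oppK okK.
Let oV := ok_vtx_opp okK.

Local Notation l' := (opp K l).
Local Notation m' := (opp K m).
Local Notation el := (edge K l).
Local Notation em := (edge K m).
Local Notation el' := (opp K (edge K l)).
Local Notation em' := (opp K (edge K m)).

Definition r2_joining : H -> H :=
  tperm (opp K l) (opp K (edge K l)) \o tperm (opp K m) (opp K (edge K m)).

Definition r2_verts : {set V} := [set vtx K l; vtx K (edge K l)].

Let vw : vtx K l != vtx K el. Proof. by case/and4P: frag. Qed.
Let adj_lm : adjacent K l m. Proof. by case/and4P: frag. Qed.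
Let adj_e : adjacent K el em. Proof. by case/and4P: frag. Qed.
Let vm : vtx K m = vtx K l. Proof. by case/and3P: adj_lm => /eqP. Qed.
Let wm : vtx K em = vtx K el. Proof. by case/and3P: adj_e => /eqP. Qed.

Definition r2_half_edges : seq H := [:: l; m; l'; m'; el; em; el'; em'].

Lemma r2_uniq : uniq r2_half_edges.
Proof.
rewrite /r2_half_edges -[_ :: _]/([:: l; m; l'; m'] ++ [:: el; em; el'; em']).
rewrite cat_uniq !adjacent_uniq // andbT andTb.
apply/hasPn => x xw; apply: contra vw => /= xv.
have <- : vtx K x = vtx K l.
  by move: xv; rewrite !inE => /or4P[]/eqP->; rewrite ?oV ?vm.
by apply/eqP; move: xw; rewrite !inE => /or4P[]/eqP->; rewrite ?oV ?wm.
Qed.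

Lemma r2_at_vertices x : (vtx K x \in r2_verts) = (x \in r2_half_edges).
Proof.
have [_ sK] := okK; rewrite !inE; apply/idP/idP.
  case/orP=> /eqP xv.
    by have := at_vertex sK adj_lm xv; rewrite !inE => /or4P[]->; rewrite ?orbT.
  by have := at_vertex sK adj_e xv; rewrite !inE => /or4P[]->; rewrite ?orbT.
by split_ors; move/eqP->; rewrite ?oV ?vm ?wm eqxx ?orbT.
Qed.

Lemma r2_joiningE :
  [/\ r2_joining l' = el', r2_joining el' = l', r2_joining m' = em',
      r2_joining em' = m' &
      forall x, x \notin [:: l'; el'; m'; em'] -> r2_joining x = x].
Proof.
have := r2_uniq; rewrite /r2_half_edges /= !inE !negb_or.
move=> ?; split_ands; rewrite /r2_joining /=.
split.
- by rewrite (tpermD (z := l')) ?tpermL; eq_simp.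
- by rewrite (tpermD (z := el')) ?tpermR; eq_simp.
- by rewrite tpermL tpermD; eq_simp.
- by rewrite tpermR tpermD; eq_simp.
move=> x; rewrite !inE !negb_or => /and4P[a b c d].
by rewrite !tpermD; eq_simp.
Qed.

Lemma r2_splicing : splicing K r2_verts r2_joining.
Proof.
have [j1 j2 j3 j4 j5] := r2_joiningE.
have [Ke Ks] := okK.2.
have out_opp x : out K (opp K x) = out K x.
  by have /eqP := Ks x (opp K x) (esym (oV x)); rewrite eqxx orbT => /eqP/eqP.
split.
- move=> x; have [|xL] := boolP (x \in [:: l'; el'; m'; em']); last by rewrite !j5.
  by rewrite !inE => /or4P[]/eqP->; rewrite ?j1 ?j2 ?j3 ?j4 ?j1 ?j2 ?j3 ?j4.
- move=> x xD; rewrite j5 //; apply: contra xD => xL; rewrite r2_at_vertices.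
  by move: xL; rewrite !inE => /or4P[]->; rewrite ?orbT.
- move=> x; rewrite r2_at_vertices => xL jx.
  have U := r2_uniq.
  have : x \in [:: l; m; el; em].
    move: U; rewrite /r2_half_edges /= !inE !negb_or.
    move=> ?; split_ands.
    move: xL; rewrite !inE; split_ors; move/eqP=> ex; move: jx; rewrite ex ?eqxx ?orbT //;
      rewrite ?j1 ?j2 ?j3 ?j4 => /eqP; by eq_simp.
  have [f1 f2] : r2_joining l = l /\ r2_joining m = m.
    move: U; rewrite /r2_half_edges /= !inE !negb_or.
    move=> ?; split_ands; split; apply: j5; rewrite !inE; by eq_simp.
  have [f3 f4] : r2_joining el = el /\ r2_joining em = em.
    move: U; rewrite /r2_half_edges /= !inE !negb_or.
    move=> ?; split_ands; split; apply: j5; rewrite !inE; by eq_simp.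
  rewrite !inE => /or4P[]/eqP->; rewrite ?eK ?vm ?wm ?eqxx ?orbT ?f1 ?f2 ?f3 ?f4 //.
move=> x; have [|xL] := boolP (x \in [:: l'; el'; m'; em']); last by rewrite !j5 ?eqxx.
by rewrite !inE => /or4P[]/eqP-> _; rewrite ?j1 ?j2 ?j3 ?j4 !out_opp Ke ?negbK.
Qed.

Lemma r2_result_ok : graph_ok (r2_result K l m).
Proof. exact: splicing_ok okK r2_splicing. Qed.

(** Bypassing the edges of l and m in the joining by opposites joins their outer
    ends as the move does. *)
Lemma ncomp_r2 : ncomp (r2_result K l m) = ncomp K.
Proof.
have [j1 j2 j3 j4 j5] := r2_joiningE.
rewrite (ncomp_splice okK r2_splicing) ncomp_wire_loops; last by case: okK.
congr (_ + _).
have U := r2_uniq; move: U; rewrite /r2_half_edges /= !inE !negb_or.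
move=> ?; split_ands.
have b1 : bypass (edge K) (opp K) l m = m' by rewrite /bypass; eq_simp.
rewrite -(wire_loops_bypass (x := l) eK oK) //.
rewrite -[RHS](wire_loops_bypass (x := m) eK) //; last 2 first.
- by apply: bypass_inv.
- by rewrite b1.
apply: eq_wire_loops => // x; symmetry.
have [xV|xV] := boolP (vtx K x \in r2_verts); last first.
  have oxV : vtx K (opp K x) \notin r2_verts by rewrite oV.
  move: xV oxV; rewrite !r2_at_vertices.
  rewrite !inE !negb_or => ? ?; split_ands.
  by rewrite /bypass; eq_simp.
move: xV; rewrite r2_at_vertices !inE; split_ors; move/eqP->; rewrite ?j1 ?j2 ?j3 ?j4 /bypass;
  eq_simp; rewrite ?oK; eq_simp; rewrite ?oK; eq_simp => //; by rewrite j5 // !inE; eq_simp.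
Qed.

End R2.

Lemma S_space_addrr (G : groupType) (x : S_space G) : (x + x = 0)%R.
Proof.
by rewrite -[x]scale1r -scalerDl (_ : (1 + 1 = 0 :> 'F_2)%R) ?scale0r //; apply: val_inj.
Qed.

Section R2Iso.
Variables (G : groupType) (V H V' H' : finType).
Variables (K : graph_data G V H) (K' : graph_data G V' H').
Variables (fv : V -> V') (fh : H -> H') (KK' : iso_by K K' fv fh).

Lemma iso_adjacent h k : adjacent K' (fh h) (fh k) = adjacent K h k.
Proof.
have [bv [bh [[vE eE oE] [uE lE cE]]]] := KK'.
by rewrite /adjacent !vE oE !(inj_eq (bij_inj bh)) (inj_eq (bij_inj bv)).
Qed.

Lemma iso_r2_fragment l m : r2_fragment K' (fh l) (fh m) = r2_fragment K l m.
Proof.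
have [bv [bh [[vE eE oE] [uE lE cE]]]] := KK'.
by rewrite /r2_fragment !eE !iso_adjacent !vE !lE (inj_eq (bij_inj bv)).
Qed.

Lemma iso_r2_result l m : graph_ok K -> r2_fragment K l m ->
  iso (r2_result K l m) (r2_result K' (fh l) (fh m)).
Proof.
move=> okK frag; have [bv [bh [[vE eE oE] [uE lE cE]]]] := KK'.
have fI := bij_inj bh; have fvI := bij_inj bv.
apply: iso_splice KK' (r2_splicing okK frag) _ _ => //.
  by move=> v; rewrite !inE !eE !vE !(inj_eq fvI).
by move=> h; rewrite /r2_joining /= !eE !oE -!inj_tperm.
Qed.

End R2Iso.

(** On graphs without unit labels the move is a relation of the target space; it
    must also preserve the condition of having one component. *)
Lemma knot_val_r2 (G : groupType) (V H : finType) (X : graph_data G V H) l m :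
  graph_ok X -> nonunit_data X -> r2_fragment X l m ->
  knot_val X = knot_val (r2_result X l m).
Proof.
move=> okX nuX frag; have ok2 := r2_result_ok okX frag.
have nu2 : nonunit_data (r2_result X l m) by move=> v; apply: nuX.
have [X1|X1] := eqVneq (ncomp X) 1; last first.
  rewrite !knot_val0 ?ncomp_r2 //; exact/eqP.
have [N XN] := nonunit_repr okX nuX; have [N2 XN2] := nonunit_repr ok2 nu2.
rewrite (knot_valE XN); last by rewrite -(iso_ncomp XN).
rewrite (knot_valE XN2); last by rewrite -(iso_ncomp XN2) // ncomp_r2.
congr (<< _ >>)%R; apply: class_of_eq; apply: rst_step; apply: Or32.
case: (XN) => fv [fh XN']; exists (fh l), (fh m).
rewrite (iso_r2_fragment XN'); split=> //.
exact: iso_trans (iso_sym (iso_r2_result XN' okX frag)) XN2.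
Qed.

Section BracketR2.
Variables (G : groupType) (V H : finType) (K : graph_data G V H) (l m : H).
Hypotheses (okK : graph_ok K) (frag : r2_fragment K l m).

Let eK := ok_edgeK okK.
Let e0 := ok_edge_neq okK.
Let oK := ok_oppK okK.
Let oV := ok_vtx_opp okK.

Local Open Scope ring_scope.

Let vw : vtx K l != vtx K (edge K l). Proof. by case/and4P: frag. Qed.
Let adj_lm : adjacent K l m. Proof. by case/and4P: frag. Qed.
Let adj_e : adjacent K (edge K l) (edge K m). Proof. by case/and4P: frag. Qed.
Let vm : vtx K m = vtx K l. Proof. by case/and3P: adj_lm => /eqP. Qed.
Let wm : vtx K (edge K m) = vtx K (edge K l). Proof. by case/and3P: adj_e => /eqP. Qed.
Let inv_lab : label K (vtx K (edge K l)) = (label K (vtx K l))^-1%g.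
Proof. by case/and4P: frag => _ _ _ /eqP. Qed.

(** The bigon is untouched by the smoothings, and performing the move before or
    after them gives the same iterated splice. *)
Lemma bracket_r2_nonunit : label K (vtx K l) <> 1%g ->
  bracket K = bracket (r2_result K l m).
Proof.
move=> l1; have lw : label K (vtx K (edge K l)) <> 1%g.
  by rewrite inv_lab => /(congr1 (fun x => x^-1)%g); rewrite invgK invg1.
have spl2 := r2_splicing okK frag.
rewrite (bracket_splice okK spl2) -/(r2_verts K l).
have UD v : v \in units K -> v \notin r2_verts K l.
  by rewrite !inE negb_or => /eqP v1; apply/andP; split; apply: contraPneq v1 => ->.
have -> : units K :\: r2_verts K l = units K.
  by apply/setP => v; rewrite in_setD; apply: andb_idl; apply: UD.
have lU x : vtx K x \in r2_verts K l -> vtx K x \notin units K.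
  by apply: contraL; apply: UD.
apply: eq_bigr => J WJ; have spl := way_splicing okK WJ.
have [jK jl _ _] := spl; have okX := splicing_ok okK spl.
set X := splice K (units K) J in okX *.
have V1 : vtx K l \in r2_verts K l by rewrite !inE eqxx.
have V2 : vtx K (edge K l) \in r2_verts K l by rewrite !inE eqxx orbT.
have V3 : vtx K m \in r2_verts K l by rewrite vm.
have V4 : vtx K (edge K m) \in r2_verts K l by rewrite wm.
pose sub x (xV : vtx K x \in r2_verts K l) : {x | vtx K x \notin units K} := Sub x (lU x xV).
pose l1' := sub l V1; pose m1' := sub m V3.
have edgeX x xV exV : edge X (sub x xV) = sub (edge K x) exV.
  apply: val_inj; rewrite (val_edge_splice _ okK spl) /=.
  by apply: exit_edge => //; apply: (lU _).
have adjX x y xV yV : adjacent X (sub x xV) (sub y yV) = adjacent K x y.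
  by rewrite /adjacent -!val_eqE (val_opp_splice _ _ okK).
have fragX : r2_fragment X l1' m1'.
  rewrite /r2_fragment (edgeX _ _ V2) (edgeX _ _ V4) !adjX -val_eqE /=.
  by have := frag.
have nuX : nonunit_data X by move=> [v /= vU] v1; move: vU; rewrite inE v1 eqxx.
rewrite (knot_val_r2 okX nuX fragX); apply: knot_val_iso.
have spl3 := r2_splicing okX fragX.
apply: splice_splice => //.
- by apply/subsetP => v vU; rewrite inE vU orbT.
- move=> w; rewrite in_setU (negPf (valP w)) orbF.
  by rewrite !inE (edgeX _ _ V2) -!val_eqE.
- by move=> h hU; rewrite /glue (negPf (UD _ hU)).
- move=> h; rewrite /glue.
  have -> : val (r2_joining X l1' m1' h) = r2_joining K l m (val h).
    have -> : r2_joining X l1' m1' h = tperm (opp X l1') (opp X (edge X l1'))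
        (tperm (opp X m1') (opp X (edge X m1')) h) by [].
    by rewrite (edgeX _ _ V2) (edgeX _ _ V4) !(inj_tperm _ _ _ val_inj)
      !(val_opp_splice _ _ okK).
  case: ifP => // /negbT hV; rewrite jl ?(valP h) //.
  by have [_ -> ] := spl2.
- by case: spl3.
Qed.

Let D := r2_verts K l.

Let U := r2_uniq okK frag.

(** The inner edges of the bigon are removed from the paths on which they lie. *)
Let double_bypass (J : H -> H) :
  involutive J -> (forall h, vtx K h \notin D -> J h = h) ->
  graph_ok (splice K D J) -> J l != edge K l ->
  bypass (edge K) J l m != edge K m ->
  iso (splice K D J) (splice K D (bypass (edge K) (bypass (edge K) J l) m)).
Proof.
move=> JK Jl okJ n1 n2.
have [V1 V2] : vtx K l \in D /\ vtx K (edge K l) \in D by rewrite !inE !eqxx orbT.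
have [V3 V4] : vtx K m \in D /\ vtx K (edge K m) \in D by rewrite vm wm.
have step := splice_bypass okK JK Jl okJ V1 V2 n1.
apply: (iso_trans step); apply: splice_bypass => //.
- exact: bypass_inv.
- exact: (@bypass_live _ (edge K) J (fun h => vtx K h \in D)).
exact: (iso_ok step).
Qed.

Let elv : vtx K (edge K l) \notin [set vtx K l]. Proof. by rewrite inE eq_sym. Qed.
Let emv : vtx K (edge K m) \notin [set vtx K l]. Proof. by rewrite wm. Qed.
Let el1 : {h | vtx K h \notin [set vtx K l]} := Sub (edge K l) elv.
Let em1 : {h | vtx K h \notin [set vtx K l]} := Sub (edge K m) emv.

Let composite (c t : H -> H) t' (K1 := splice K [set vtx K l] c)
    (J := glue K [set vtx K l] c t) :
  splicing K [set vtx K l] c -> splicing K1 [set vtx K1 el1] t' ->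
  (forall h, val (t' h) = t (val h)) ->
  [/\ iso (splice K1 [set vtx K1 el1] t') (splice K D J), involutive J,
     forall h, vtx K h \notin D -> J h = h & graph_ok (splice K D J)].
Proof.
move=> spl spl' tE.
have sD : [set vtx K l] \subset D by rewrite sub1set !inE eqxx.
have DE (w : {v | v \notin [set vtx K l]}) : (val w \in D) = (w \in [set vtx K1 el1]).
  by rewrite !inE -val_eqE /=; have := valP w; rewrite inE => /negPf->.
have JD h : vtx K h \in [set vtx K l] -> J h = c h by rewrite /J /glue => ->.
have Jval (h : {h | vtx K h \notin [set vtx K l]}) : J (val h) = val (t' h).
  by rewrite /J /glue tE (negPf (valP h)).
have [t'K t'l _ _] := spl'; have ok1 := splicing_ok okK spl.
have KJ : iso (splice K1 [set vtx K1 el1] t') (splice K D J) by apply: splice_splice.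
split=> //; first exact: composite_inv JD Jval t'K.
  exact: composite_live sD DE Jval t'l.
exact: iso_ok KJ (splicing_ok ok1 spl').
Qed.

(** Write v and w for the two vertices.  JA joins l to m at v and is followed by
    the first move at w; JB and JC join l to the opposite of m at v, and are the two
    smoothings at w.  After bypassing the edges of the bigon, JA and JB join the outer
    ends at v to each other and likewise at w, while JC is the second move. *)
Lemma bracket_r2_unit : label K (vtx K l) = 1%g ->
  bracket K = bracket (r2_result K l m).
Proof.
move=> l1; have lw : label K (vtx K (edge K l)) = 1%g by rewrite inv_lab l1 invg1.
have [fK _] := okK; have adj' := adjacent_opp adj_lm fK.
have adj_e' := adjacent_opp adj_e fK.
have splA := corner_splicing okK adj_lm; have splB := corner_splicing okK adj'.
rewrite (skein okK adj_lm l1).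
set K0 := splice K _ (corner K l m); set K1 := splice K _ (corner K l (opp K m)).
have ok0 : graph_ok K0 by apply: splicing_ok.
have ok1 : graph_ok K1 by apply: splicing_ok.
have [a1 a2 a3 a4 _] := cornerE fK adj_lm.
have [b1 b2 b3 b4 _] := cornerE fK adj'.
have [c1 c2 c3 c4 _] := cornerE fK adj_e.
have [d1 d2 d3 d4 _] := cornerE fK adj_e'.
have e01 : edge K0 el1 = em1.
  apply: val_inj; rewrite (val_edge_splice _ okK splA).
  have [cK cl _ _] := splA.
  have : connect (link (edge K) (corner K l m)) (edge K l) (edge K m).
    apply: connect_trans (link_e _ _ _) _; rewrite eK.
    apply: connect_trans (link_j _ _ _) _; rewrite a1; exact: link_e.
  case/(exit_uniq eK cK cl elv emv) => // ee.
  by have /and3P[_ /eqP] := adj_e; rewrite ee.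
have fragA : r1_fragment K0 el1.
  rewrite /r1_fragment e01 /= lw eqxx andbT /adjacent -!val_eqE (val_opp_splice _ _ okK).
  exact: adj_e.
have adj1 : adjacent K1 el1 em1.
  by rewrite /adjacent -!val_eqE (val_opp_splice _ _ okK); exact: adj_e.
have adj1' := adjacent_opp adj1 ok1.1.
have oE (x : {h | vtx K h \notin [set vtx K l]}) : val (opp K1 x) = opp K (val x).
  exact: val_opp_splice.
rewrite (bracket_r1 ok0 fragA) (skein ok1 adj1) //.
have splA' := r1_splicing ok0 fragA.
have splB' := corner_splicing ok1 adj1; have splC' := corner_splicing ok1 adj1'.
have [|isoA JAK JAl okA] :=
  composite (t := tperm (opp K (edge K l)) (opp K (edge K m))) splA splA'.
  move=> h; rewrite e01 (inj_tperm _ _ _ val_inj).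
  by rewrite !(val_opp_splice _ _ okK).
have [|isoB JBK JBl okB] :=
  composite (t := corner K (edge K l) (edge K m)) splB splB'.
  by move=> h; rewrite /corner /= !(inj_tperm _ _ _ val_inj) !oE.
have [|isoC JCK JCl okC] :=
  composite (t := corner K (edge K l) (opp K (edge K m))) splB splC'.
  by move=> h; rewrite /corner /= !(inj_tperm _ _ _ val_inj) !oE.
rewrite (bracket_iso (splicing_ok ok0 splA') isoA).
rewrite (bracket_iso (splicing_ok ok1 splB') isoB).
rewrite (bracket_iso (splicing_ok ok1 splC') isoC) {isoA isoB isoC splA' splB' splC'}.
set JA := glue K _ (corner K l m) _ in JAK JAl okA *.
set JB := glue K _ _ (corner _ _ (edge K m)) in JBK JBl okB *.
set JC := glue K _ _ _ in JCK JCl okC *.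
have := U; rewrite /r2_half_edges /= !inE !negb_or => ?; split_ands.
have wv : vtx K (edge K l) == vtx K l = false by rewrite eq_sym (negPf vw).
have A : (JA l = m) * (JA m = l) * (JA (opp K l) = opp K m) * (JA (opp K m) = opp K l)
  * (JA (edge K l) = edge K l) * (JA (edge K m) = edge K m)
  * (JA (opp K (edge K l)) = opp K (edge K m)) * (JA (opp K (edge K m)) = opp K (edge K l)).
  by rewrite /JA /glue !inE !oV vm wm wv eqxx a1 a2 a3 a4 tpermL tpermR !tpermD; eq_simp.
rewrite !oK in b3 b4 d3 d4.
have B : (JB l = opp K m) * (JB m = opp K l) * (JB (opp K l) = m) * (JB (opp K m) = l)
  * (JB (edge K l) = edge K m) * (JB (edge K m) = edge K l)
  * (JB (opp K (edge K l)) = opp K (edge K m)) * (JB (opp K (edge K m)) = opp K (edge K l)).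
  by rewrite /JB /glue !inE !oV vm wm wv eqxx b1 b2 b3 b4 c1 c2 c3 c4.
have C : (JC l = opp K m) * (JC m = opp K l) * (JC (opp K l) = m) * (JC (opp K m) = l)
  * (JC (edge K l) = opp K (edge K m)) * (JC (edge K m) = opp K (edge K l))
  * (JC (opp K (edge K l)) = edge K m) * (JC (opp K (edge K m)) = edge K l).
  by rewrite /JC /glue !inE !oV vm wm wv eqxx b1 b2 b3 b4 d1 d2 d3 d4.
have [r1 r2 r3 r4 r5] := r2_joiningE okK frag.
have rA := double_bypass JAK JAl okA; have rB := double_bypass JBK JBl okB.
have rC := double_bypass JCK JCl okC.
rewrite (bracket_iso okA (rA _ _)); try by rewrite /bypass; do 3! (rewrite ?A; eq_simp).
rewrite (bracket_iso okB (rB _ _)); try by rewrite /bypass; do 3! (rewrite ?B; eq_simp).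
rewrite (bracket_iso okC (rC _ _)); try by rewrite /bypass; do 3! (rewrite ?C; eq_simp).
have atD := r2_at_vertices okK frag.
have -> : bypass (edge K) (bypass (edge K) JA l) m = bypass (edge K) (bypass (edge K) JB l) m.
  apply/funext => x; have [xD|xD] := boolP (vtx K x \in D); last first.
    move: (xD); rewrite atD !inE !negb_or => ?; split_ands.
    by rewrite /bypass (JAl x xD) (JBl x xD); eq_simp.
  move: (xD); rewrite atD !inE; split_ors; move/eqP->;
   by rewrite /bypass; do 6! (rewrite ?A ?B; eq_simp).
rewrite addrA S_space_addrr add0r; congr (bracket (splice K _ _)).
apply/funext => x; rewrite -[RHS]/(r2_joining K l m x).
have [xD|xD] := boolP (vtx K x \in D); last first.
  have [_ -> //] := r2_splicing okK frag.
  move: (xD); rewrite atD !inE !negb_or => ?; split_ands.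
  by rewrite /bypass (JCl x xD); eq_simp.
move: (xD); rewrite atD !inE; split_ors; move/eqP->.
all: rewrite ?r1 ?r2 ?r3 ?r4 /bypass; do 6! (rewrite ?C; eq_simp) => //.
all: by rewrite r5 // !inE; eq_simp.
Qed.

Lemma bracket_r2 : bracket K = bracket (r2_result K l m).
Proof.
have [l1|/eqP l1] := eqVneq (label K (vtx K l)) 1%g.
  exact: bracket_r2_unit.
exact: bracket_r2_nonunit.
Qed.

End BracketR2.

(** * The third move *)

(** The fragment of the third move without its labels and orientations.  Unlike
    [r3_fragment], it makes the same demands on both sides of the move. *)
Definition triangle (G : groupType) (V H : finType) (K : graph_data G V H) (a b c : H) :=
  [&& [&& vtx K a != vtx K b, vtx K b != vtx K c & vtx K c != vtx K a]
    & [&& adjacent K (edge K a) b, adjacent K (edge K b) c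
        & adjacent K (edge K c) a]].

Lemma r3_fragment_triangle (G : groupType) (V H : finType) (K : graph_data G V H) a b c :
  r3_fragment K a b c -> triangle K a b c.
Proof. by case/and4P=> _ t1 t2 _; apply/andP. Qed.

Section R3.
Variables (G : groupType) (V H : finType) (K : graph_data G V H) (a b c : H).
Hypotheses (okK : graph_ok K) (tri : triangle K a b c).

Let eK := ok_edgeK okK.
Let oK := ok_oppK okK.
Let oV := ok_vtx_opp okK.

Local Notation ea := (edge K a).
Local Notation eb := (edge K b).
Local Notation ec := (edge K c).
Local Notation oa := (opp K a).
Local Notation ob := (opp K b).
Local Notation oc := (opp K c).
Local Notation oea := (opp K (edge K a)).
Local Notation oeb := (opp K (edge K b)).
Local Notation oec := (opp K (edge K c)).

Let nAB : vtx K a != vtx K b. Proof. by case/andP: tri => /and3P[]. Qed.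
Let nBC : vtx K b != vtx K c. Proof. by case/andP: tri => /and3P[]. Qed.
Let nCA : vtx K c != vtx K a. Proof. by case/andP: tri => /and3P[]. Qed.
Let adjB : adjacent K ea b. Proof. by case/andP: tri => _ /and3P[]. Qed.
Let adjC : adjacent K eb c. Proof. by case/andP: tri => _ /and3P[]. Qed.
Let adjA : adjacent K ec a. Proof. by case/andP: tri => _ /and3P[]. Qed.
Let vea : vtx K ea = vtx K b. Proof. by case/and3P: adjB => /eqP. Qed.
Let veb : vtx K eb = vtx K c. Proof. by case/and3P: adjC => /eqP. Qed.
Let vec : vtx K ec = vtx K a. Proof. by case/and3P: adjA => /eqP. Qed.

Definition r3_half_edges : seq H :=
  [:: ec; a; oec; oa; ea; b; oea; ob; eb; c; oeb; oc].

Definition r3_verts : {set V} := [set v in [:: vtx K a; vtx K b; vtx K c]].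

Lemma r3_uniq : uniq r3_half_edges.
Proof.
have disj (v w : V) (s t : seq H) : v != w -> {in s, forall x, vtx K x = v} ->
    {in t, forall x, vtx K x = w} -> ~~ has [in s] t.
  move=> vw sv tw; apply/hasPn => x xt; apply: contra vw => /= xs.
  by rewrite -(sv x xs) (tw x xt).
have tA : {in [:: ec; a; oec; oa], forall x, vtx K x = vtx K a}.
  by move=> x; rewrite !inE => /or4P[]/eqP->; rewrite ?oV ?vec.
have tB : {in [:: ea; b; oea; ob], forall x, vtx K x = vtx K b}.
  by move=> x; rewrite !inE => /or4P[]/eqP->; rewrite ?oV ?vea.
have tC : {in [:: eb; c; oeb; oc], forall x, vtx K x = vtx K c}.
  by move=> x; rewrite !inE => /or4P[]/eqP->; rewrite ?oV ?veb.
have -> : r3_half_edges = [:: ec; a; oec; oa] ++ [:: ea; b; oea; ob] ++ [:: eb; c; oeb; oc].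
  by [].
rewrite cat_uniq cat_uniq has_cat negb_or !adjacent_uniq //.
rewrite (disj _ _ _ _ nAB tA tB) (disj _ _ _ _ nBC tB tC) /=.
by rewrite (disj _ _ _ _ _ tA tC) // eq_sym.
Qed.

Lemma r3_at_vertices x : (vtx K x \in r3_verts) = (x \in r3_half_edges).
Proof.
have [_ sK] := okK; rewrite !inE; apply/idP/idP.
  case/or3P=> /eqP xv.
  - have := at_vertex sK adjA (etrans xv (esym vec)).
    by rewrite !inE => /or4P[]->; rewrite ?orbT.
  - have := at_vertex sK adjB (etrans xv (esym vea)).
    by rewrite !inE => /or4P[]->; rewrite ?orbT.
  have := at_vertex sK adjC (etrans xv (esym veb)).
  by rewrite !inE => /or4P[]->; rewrite ?orbT.
by split_ors; move/eqP->; rewrite ?oV ?vea ?veb ?vec eqxx ?orbT.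
Qed.

Local Notation s := (r3_swap K a b c).

Lemma r3_swapE :
  [/\ (s oa = oea) * (s oea = oa), (s ob = oeb) * (s oeb = ob),
      (s oc = oec) * (s oec = oc)
    & forall x, x \notin [:: oa; oea; ob; oeb; oc; oec] -> s x = x].
Proof.
have := r3_uniq; rewrite /r3_half_edges /= !inE !negb_or => ?; split_ands.
rewrite /r3_swap /=; split.
- by split; tperm_simp.
- by split; tperm_simp.
- by split; tperm_simp.
move=> x; rewrite !inE !negb_or => ?; split_ands.
by tperm_simp.
Qed.

Local Notation K3 := (r3_result K a b c).

Lemma r3_swap_out x : x \notin r3_half_edges -> s x = x.
Proof.
have [_ _ _ s7] := r3_swapE => xL; apply: s7; apply: contra xL.
by rewrite !inE; split_ors; move=> ->; rewrite ?orbT.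
Qed.

(** The strand opp a - a - edge a - opp (edge a) is replaced by
    opp a - edge a - a - opp (edge a), and similarly for the other two strands. *)
Lemma r3_oppE :
  [/\ (opp K3 a = oea) * (opp K3 oea = a) * (opp K3 ea = oa) * (opp K3 oa = ea),
      (opp K3 b = oeb) * (opp K3 oeb = b) * (opp K3 eb = ob) * (opp K3 ob = eb),
      (opp K3 c = oec) * (opp K3 oec = c) * (opp K3 ec = oc) * (opp K3 oc = ec)
    & forall x, x \notin r3_half_edges -> opp K3 x = opp K x].
Proof.
have [[s1 s2] [s3 s4] [s5 s6] s7] := r3_swapE.
have := r3_uniq; rewrite /r3_half_edges /= !inE !negb_or => ?; split_ands.
have t x : x \in [:: a; b; c; ea; eb; ec] -> s x = x.
  move=> xL; apply: s7; move: xL; rewrite !inE; split_ors; move/eqP->; by eq_simp.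
have [ta tb tc] : [/\ s a = a, s b = b & s c = c].
  by split; apply: t; rewrite !inE eqxx ?orbT.
have [tea teb tec] : [/\ s ea = ea, s eb = eb & s ec = ec].
  by split; apply: t; rewrite !inE eqxx ?orbT.
split.
- by rewrite ta tea s1 s2 !oK ta tea.
- by rewrite tb teb s3 s4 !oK tb teb.
- by rewrite tc tec s5 s6 !oK tc tec.
move=> x xL; rewrite (r3_swap_out xL) r3_swap_out //.
by rewrite -r3_at_vertices oV r3_at_vertices.
Qed.

Lemma r3_vtxE :
  [/\ (vtx K3 a = vtx K a) * (vtx K3 ec = vtx K a) * (vtx K3 oea = vtx K a) * (vtx K3 oc = vtx K a),
      (vtx K3 b = vtx K b) * (vtx K3 ea = vtx K b) * (vtx K3 oeb = vtx K b) * (vtx K3 oa = vtx K b),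
      (vtx K3 c = vtx K c) * (vtx K3 eb = vtx K c) * (vtx K3 oec = vtx K c) * (vtx K3 ob = vtx K c)
    & forall x, x \notin r3_half_edges -> vtx K3 x = vtx K x].
Proof.
have [[s1 s2] [s3 s4] [s5 s6] s7] := r3_swapE.
have := r3_uniq; rewrite /r3_half_edges /= !inE !negb_or => ?; split_ands.
have t x : x \in [:: a; b; c; ea; eb; ec] -> s x = x.
  move=> xL; apply: s7; move: xL; rewrite !inE; split_ors; move/eqP->; by eq_simp.
have [ta tb tc] : [/\ s a = a, s b = b & s c = c].
  by split; apply: t; rewrite !inE eqxx ?orbT.
have [tea teb tec] : [/\ s ea = ea, s eb = eb & s ec = ec].
  by split; apply: t; rewrite !inE eqxx ?orbT.
split.
- by rewrite ta tec s2 s5 !oV vec.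
- by rewrite tb tea s4 s1 !oV vea.
- by rewrite tc teb s6 s3 !oV veb.
by move=> x xL; rewrite (r3_swap_out xL).
Qed.

Lemma r3_vtx_verts x : (vtx K3 x \in r3_verts) = (vtx K x \in r3_verts).
Proof.
have [v1 v2 v3 v4] := r3_vtxE.
have [xL|xL] := boolP (x \in r3_half_edges); last by rewrite v4.
rewrite [RHS]r3_at_vertices xL; move: xL; rewrite !inE.
by split_ors; move/eqP->; rewrite ?v1 ?v2 ?v3 eqxx ?orbT.
Qed.

Lemma r3_triangle : triangle K3 a b c.
Proof.
have [v1 v2 v3 _] := r3_vtxE; have [o1 o2 o3 _] := r3_oppE.
have := r3_uniq; rewrite /r3_half_edges /= !inE !negb_or => ?; split_ands.
rewrite /triangle /adjacent -![edge K3 _]/(edge K _) !v1 !v2 !v3 !o1 !o2 !o3 nAB nBC nCA !eqxx.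
by eq_simp.
Qed.

Hypothesis ok3 : graph_ok K3.

(** Exchanging the ends of each triangle edge commutes with [edge K] and conjugates
    [opp K] into its counterpart after the move. *)
Let flip x := if x \in [:: a; ea; b; eb; c; ec] then edge K x else x.

Let e_flip_mem y :
  (edge K y \in [:: a; ea; b; eb; c; ec]) = (y \in [:: a; ea; b; eb; c; ec]).
Proof.
rewrite !inE !(inj_eq (inv_inj eK)) !(inv_eq eK).
by do 6!case: (y == _).
Qed.

Let flip_e x : edge K (flip x) = flip (edge K x).
Proof. by rewrite /flip e_flip_mem; case: ifP. Qed.

(** Reversing the order of the two vertices on a strand does not change which
    outer half-edges it connects. *)
Lemma ncomp_r3 : ncomp K3 = ncomp K.
Proof.
have [o1 o2 o3 o4] := r3_oppE.
rewrite !ncomp_wire_loops; [|by case: okK|by case: ok3]; congr (_ + _).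
have oK3 : involutive (opp K3) by case: ok3 => -[].
have flipK : involutive flip.
  by move=> x; rewrite /flip; case: (boolP (x \in _)) => [xL|/negPf-> //]; rewrite e_flip_mem xL eK.
symmetry; apply: (@wire_loops_bij _ _ flip) => // [|x]; first by exists flip.
rewrite -[LHS]/(opp K3 (flip x)); move: (opp K3) o1 o2 o3 o4 => o3K o1 o2 o3 o4.
have := r3_uniq; rewrite /r3_half_edges /= !inE !negb_or => ?; split_ands.
have [f1 f2 f3] : [/\ flip a = ea, flip b = eb & flip c = ec].
  by rewrite /flip !inE !eqxx !orbT.
have [f4 f5 f6] : [/\ flip ea = a, flip eb = b & flip ec = c].
  by rewrite /flip !inE !eqxx !orbT !eK.
have out y : y \notin [:: a; ea; b; eb; c; ec] -> flip y = y.
  by rewrite /flip => /negPf->.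
have [g1 g2 g3] : [/\ flip oa = oa, flip ob = ob & flip oc = oc].
  by split; apply: out; rewrite !inE; eq_simp.
have [g4 g5 g6] : [/\ flip oea = oea, flip oeb = oeb & flip oec = oec].
  by split; apply: out; rewrite !inE; eq_simp.
have [xL|xL] := boolP (x \in r3_half_edges).
  by move: xL; rewrite !inE; split_ors; move/eqP->;
    rewrite ?oK ?f1 ?f2 ?f3 ?f4 ?f5 ?f6 ?g1 ?g2 ?g3 ?g4 ?g5 ?g6 ?o1 ?o2 ?o3.
have sub y : y \notin r3_half_edges -> flip y = y.
  move=> yL; apply: out; apply: contra yL; rewrite !inE; split_ors; move->; by rewrite ?orbT.
rewrite (sub x xL) (o4 x xL) sub //.
by rewrite -r3_at_vertices oV r3_at_vertices.
Qed.

End R3.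

Section R3Iso.
Variables (G : groupType) (V H V' H' : finType).
Variables (K : graph_data G V H) (K' : graph_data G V' H').
Variables (fv : V -> V') (fh : H -> H') (KK' : iso_by K K' fv fh).
Variables a b c : H.

Lemma iso_r3_fragment :
  r3_fragment K' (fh a) (fh b) (fh c) = r3_fragment K a b c.
Proof.
have [bv [bh [[vE eE oE] [uE lE cE]]]] := KK'.
rewrite /r3_fragment !eE !(iso_adjacent KK') !vE !lE !uE.
by rewrite !(inj_eq (bij_inj bv)).
Qed.

Lemma iso_r3_result :
  iso (r3_result K a b c) (r3_result K' (fh a) (fh b) (fh c)).
Proof.
have [bv [bh [[vE eE oE] [uE lE cE]]]] := KK'.
have fI := bij_inj bh; have fvI := bij_inj bv.
have sE h : r3_swap K' (fh a) (fh b) (fh c) (fh h) = fh (r3_swap K a b c h).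
  by rewrite /r3_swap /= !eE !oE -!inj_tperm.
exists fv, fh; split=> //; split=> //; split; split=> // x.
- transitivity (vtx K' (r3_swap K' (fh a) (fh b) (fh c) (fh x))) => //.
  by rewrite sE vE.
- transitivity (r3_swap K' (fh a) (fh b) (fh c)
    (opp K' (r3_swap K' (fh a) (fh b) (fh c) (fh x)))) => //.
  by rewrite sE oE sE.
- by rewrite /= uE !inE !eE !(inj_eq fI).
by rewrite /= lE !inE !vE !(inj_eq fvI).
Qed.

End R3Iso.

Lemma knot_val_r3 (G : groupType) (V H : finType) (X : graph_data G V H) a b c :
  graph_ok X -> nonunit_data X -> r3_fragment X a b c ->
  graph_ok (r3_result X a b c) ->
  knot_val X = knot_val (r3_result X a b c).
Proof.
move=> okX nuX frag ok3; have tri := r3_fragment_triangle frag.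
have nu3 : nonunit_data (r3_result X a b c).
  move=> v /=; case: ifP => _; last exact: nuX.
  by move/(congr1 (fun x => x^-1)%g); rewrite invgK invg1; apply: nuX.
have [X1|X1] := eqVneq (ncomp X) 1; last first.
  by rewrite !knot_val0 ?ncomp_r3 //; apply/eqP.
have [N XN] := nonunit_repr okX nuX; have [N3 XN3] := nonunit_repr ok3 nu3.
rewrite (knot_valE XN); last by rewrite -(iso_ncomp XN).
rewrite (knot_valE XN3); last by rewrite -(iso_ncomp XN3) // ncomp_r3.
congr (<< _ >>)%R; apply: class_of_eq; apply: rst_step; apply: Or33.
case: (XN) => fv [fh XN']; exists (fh a), (fh b), (fh c).
rewrite (iso_r3_fragment XN'); split=> //.
exact: (iso_trans (iso_sym (iso_r3_result XN' a b c))).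
Qed.

Section BracketR3.
Variables (G : groupType) (V H : finType) (K : graph_data G V H) (a b c : H).
Hypotheses (okK : graph_ok K) (frag : r3_fragment K a b c).
Local Notation K3 := (r3_result K a b c).
Hypothesis ok3 : graph_ok K3.

Let eK := ok_edgeK okK.

Let tri := r3_fragment_triangle frag.

(** The triangle is untouched by the smoothings, and the move changes neither the
    other vertices nor the edges along which joined paths are followed. *)
Lemma bracket_r3_nonunit : label K (vtx K a) <> 1%g ->
  label K (vtx K b) <> 1%g -> label K (vtx K c) <> 1%g ->
  bracket K = bracket K3.
Proof.
move=> a1 b1 c1.
have lV v : v \in r3_verts K a b c -> label K v <> 1%g.
  by rewrite !inE => /or3P[]/eqP->.
have UD v : v \in units K -> v \notin r3_verts K a b c.
  by rewrite inE => /eqP v1; apply/negP => /lV.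
have UE : units K3 = units K.
  apply/setP => v; rewrite !inE /=; case: ifP => // vL; apply/eqP/eqP => v1.
    by rewrite -[label K v]invgK v1 invg1.
  by rewrite v1 invg1.
have vtxU x : (vtx K3 x \in units K) = (vtx K x \in units K).
  apply/idP/idP => xU.
    have := UD _ xU; rewrite r3_vtx_verts // r3_at_vertices // => xL.
    by have [_ _ _ <-] := r3_vtxE okK tri.
  have := UD _ xU; rewrite r3_at_vertices // => xL.
  by have [_ _ _ ->] := r3_vtxE okK tri.
have far x : vtx K x \in units K -> x \notin r3_half_edges K a b c.
  by move/UD; rewrite r3_at_vertices.
have [_ _ _ vE] := r3_vtxE okK tri; have [_ _ _ oE] := r3_oppE okK tri.
have WE J : way K (units K) J = way K3 (units K) J.
  apply: eq_forallb => x; rewrite vtxU; case: ifP => // xU; congr (_ && _).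
  have xL := far x xU.
  rewrite /adjacent (vE x xL) (oE x xL); congr (_ && _).
  have [JL|JL] := boolP (J x \in r3_half_edges K a b c); last by rewrite vE.
  move: JL; rewrite -r3_at_vertices // => JV.
  transitivity false; last apply/esym.
    apply: contraTF xU => /eqP->; apply/negP => /UD; by rewrite JV.
  apply: contraTF xU => /eqP->; apply/negP => /UD; by rewrite r3_vtx_verts // JV.
rewrite /bracket UE; apply: eq_big => [//|J WJ].
have spl := way_splicing okK WJ; have W3 := WJ; rewrite WE in W3.
have okX := splicing_ok okK spl; have [jK jl _ _] := spl.
set X := splice K (units K) J in okX *.
have lU x : vtx K x \in r3_verts K a b c -> vtx K x \notin units K.
  by apply: contraL; apply: UD.
have Va : vtx K a \in r3_verts K a b c by rewrite r3_at_vertices // !inE eqxx ?orbT.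
have Vb : vtx K b \in r3_verts K a b c by rewrite r3_at_vertices // !inE eqxx ?orbT.
have Vc : vtx K c \in r3_verts K a b c by rewrite r3_at_vertices // !inE eqxx ?orbT.
have Vea : vtx K (edge K a) \in r3_verts K a b c by rewrite r3_at_vertices // !inE eqxx ?orbT.
have Veb : vtx K (edge K b) \in r3_verts K a b c by rewrite r3_at_vertices // !inE eqxx ?orbT.
have Vec : vtx K (edge K c) \in r3_verts K a b c by rewrite r3_at_vertices // !inE eqxx ?orbT.
pose sub x (xV : vtx K x \in r3_verts K a b c) : {x | vtx K x \notin units K} :=
  Sub x (lU x xV).
have edgeX x xV exV : edge X (sub x xV) = sub (edge K x) exV.
  apply: val_inj; rewrite (val_edge_splice _ okK spl) /=.
  by apply: exit_edge => //; apply: (lU _).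
have adjX x y xV yV : adjacent X (sub x xV) (sub y yV) = adjacent K x y.
  by rewrite /adjacent -!val_eqE (val_opp_splice _ _ okK).
have fragX : r3_fragment X (sub a Va) (sub b Vb) (sub c Vc).
  rewrite /r3_fragment (edgeX _ _ Vea) (edgeX _ _ Veb) (edgeX _ _ Vec) !adjX -!val_eqE /=.
  exact: frag.
have nuX : nonunit_data X by move=> [v /= vU] v1; move: vU; rewrite inE v1 eqxx.
have sX h : val (r3_swap X (sub a Va) (sub b Vb) (sub c Vc) h) = r3_swap K a b c (val h).
  have -> : r3_swap X (sub a Va) (sub b Vb) (sub c Vc) h =
    tperm (opp X (sub a Va)) (opp X (edge X (sub a Va)))
     (tperm (opp X (sub b Vb)) (opp X (edge X (sub b Vb)))
      (tperm (opp X (sub c Vc)) (opp X (edge X (sub c Vc))) h)) by [].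
  by rewrite (edgeX _ _ Vea) (edgeX _ _ Veb) (edgeX _ _ Vec) !(inj_tperm _ _ _ val_inj)
    !(val_opp_splice _ _ okK).
have Xiso : iso (r3_result X (sub a Va) (sub b Vb) (sub c Vc)) (splice K3 (units K) J).
  have [[eXK eX0 _ _ _] _] := okX.
  apply: (@splice_iso _ _ _ _ _ K3 _ (units K) J val val) => //.
  - by move=> h; rewrite vtxU; apply: jl.
  - exact: ok_vtx_opp ok3.
  - exact: val_inj.
  - exact: val_inj.
  - by move=> w; apply: valP w.
  - by move=> v vU; exists (Sub v vU).
  - by move=> h; rewrite vtxU => hU; exists (Sub h hU).
  - by move=> k; rewrite -[LHS]/(vtx K (r3_swap K a b c (val k))) -sX.
  - move=> k; rewrite -[edge (r3_result X _ _ _) k]/(edge X k).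
    rewrite (val_edge_splice _ okK spl).
    exact: exit_connect (valP k).
  - move=> k; rewrite -[LHS]/(r3_swap K a b c (opp K (r3_swap K a b c (val k)))).
    by rewrite -sX -(val_opp_splice J _ okK) -sX.
  - move=> k; have -> : out (r3_result X (sub a Va) (sub b Vb) (sub c Vc)) k = out X k
      (+) (k \in [:: sub a Va; edge X (sub a Va); sub b Vb; edge X (sub b Vb);
                      sub c Vc; edge X (sub c Vc)]) by [].
    by rewrite (edgeX _ _ Vea) (edgeX _ _ Veb) (edgeX _ _ Vec) !inE -!val_eqE /= !inE.
  congr (_ + _)%N; apply: eq_wire_loops => // h; exact: vtxU.
have okX3 := iso_ok (iso_sym Xiso) (splicing_ok ok3 (way_splicing ok3 W3)).
by rewrite (knot_val_r3 okX nuX fragX okX3); apply: knot_val_iso.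
Qed.

End BracketR3.

Section Corner.
Variables (G : groupType) (V H : finType) (K : graph_data G V H) (a b c : H).
Hypotheses (okK : graph_ok K) (tri : triangle K a b c).
Hypothesis labC : label K (vtx K c) = (label K (vtx K b))^-1%g.

Let eK := ok_edgeK okK.
Let oK := ok_oppK okK.

Let nAB : vtx K a != vtx K b. Proof. by case/andP: tri => /and3P[]. Qed.
Let nBC : vtx K b != vtx K c. Proof. by case/andP: tri => /and3P[]. Qed.
Let nCA : vtx K c != vtx K a. Proof. by case/andP: tri => /and3P[]. Qed.
Let adjB : adjacent K (edge K a) b. Proof. by case/andP: tri => _ /and3P[]. Qed.
Let adjC : adjacent K (edge K b) c. Proof. by case/andP: tri => _ /and3P[]. Qed.
Let adjA : adjacent K a (edge K c).
Proof. by apply: adjacent_sym okK.1; case/andP: tri => _ /and3P[]. Qed.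
Let vea : vtx K (edge K a) = vtx K b. Proof. by case/and3P: adjB => /eqP. Qed.
Let veb : vtx K (edge K b) = vtx K c. Proof. by case/and3P: adjC => /eqP. Qed.

(** The smoothing of A along the corner of the triangle, followed by the second
    move which removes the bigon between B and C. *)
Definition r3_corner (h : H) : H :=
  if vtx K h == vtx K a then corner K a (edge K c) h
  else tperm (opp K b) (opp K (edge K b)) (tperm (opp K (edge K a)) (opp K c) h).

(** After this smoothing the edges C -> A and A -> B become one edge between C
    and B, which bounds a bigon with B -> C. *)
Lemma bracket_corner :
  [/\ bracket (splice K [set vtx K a] (corner K a (edge K c))) =
        bracket (splice K (r3_verts K a b c) r3_corner),
      graph_ok (splice K (r3_verts K a b c) r3_corner),
      involutive r3_corner &
      forall h, vtx K h \notin r3_verts K a b c -> r3_corner h = h].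
Proof.
have spl := corner_splicing okK adjA; set K1 := splice K _ _.
have ok1 : graph_ok K1 by apply: splicing_ok.
have Lb : vtx K b \notin [set vtx K a] by rewrite inE eq_sym.
have Lc : vtx K c \notin [set vtx K a] by rewrite inE.
have Lea : vtx K (edge K a) \notin [set vtx K a] by rewrite vea.
have Leb : vtx K (edge K b) \notin [set vtx K a] by rewrite veb.
pose T := {x | vtx K x \notin [set vtx K a]}.
pose b1 : T := Sub b Lb; pose c1 : T := Sub c Lc.
pose ea1 : T := Sub (edge K a) Lea; pose eb1 : T := Sub (edge K b) Leb.
have [k1 _ _ _ _] := cornerE okK.1 adjA.
have [jK jl _ _] := spl.
have Eb : edge K1 b1 = eb1.
  by apply: val_inj; rewrite (val_edge_splice _ okK spl) /=; apply: exit_edge.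
have Ea : edge K1 ea1 = c1.
  apply: val_inj; rewrite (val_edge_splice _ okK spl) /=.
  have : connect (link (edge K) (corner K a (edge K c))) (edge K a) c.
    apply: connect_trans (link_e _ _ _) _; rewrite eK.
    apply: connect_trans (link_j _ _ _) _; rewrite k1.
    by have := link_e (edge K) (corner K a (edge K c)) (edge K c); rewrite eK.
  case/(exit_uniq eK jK jl Lea Lc) => // cea.
  by move/eqP: nBC; rewrite cea vea.
have adjX x y xV yV : adjacent K1 (Sub x xV : T) (Sub y yV) = adjacent K x y.
  by rewrite /adjacent -!val_eqE (val_opp_splice _ _ okK).
have frag : r2_fragment K1 b1 ea1.
  rewrite /r2_fragment Eb Ea !adjX -val_eqE /= veb nBC adjC labC eqxx.
  by rewrite (adjacent_sym adjB okK.1).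
have spl2 := r2_splicing ok1 frag.
have Jval (h : T) : r3_corner (val h) = val (r2_joining K1 b1 ea1 h).
  have -> : r2_joining K1 b1 ea1 h = tperm (opp K1 b1) (opp K1 (edge K1 b1))
    (tperm (opp K1 ea1) (opp K1 (edge K1 ea1)) h) by [].
  rewrite Eb Ea !(inj_tperm _ _ _ val_inj) !(val_opp_splice _ _ okK).
  by rewrite /r3_corner; have := valP h; rewrite inE => /negPf->.
have sD : [set vtx K a] \subset r3_verts K a b c by rewrite sub1set !inE eqxx.
have DE (w : {v | v \notin [set vtx K a]}) :
    (val w \in r3_verts K a b c) = (w \in r2_verts K1 b1).
  rewrite !inE Eb -!val_eqE /= veb.
  by have := valP w; rewrite inE => /negPf->.
have JD h : vtx K h \in [set vtx K a] -> r3_corner h = corner K a (edge K c) h.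
  by rewrite inE /r3_corner => ->.
have [j2K j2l _ _] := spl2.
have KJ : iso (r2_result K1 b1 ea1) (splice K (r3_verts K a b c) r3_corner).
  exact: splice_splice.
have ok2 := r2_result_ok ok1 frag.
split.
- by rewrite (bracket_r2 ok1 frag); apply: bracket_iso.
- exact: iso_ok KJ ok2.
- exact: composite_inv JD Jval j2K.
exact: composite_live sD DE Jval j2l.
Qed.

(** The smoothed vertex stays connected to B and C by the edges of the triangle,
    so that no circle splits off. *)
Lemma splice_circles_noncorner :
  splice_circles K [set vtx K a] (corner K a (opp K (edge K c))) = 0.
Proof.
have adjA' := adjacent_opp adjA okK.1.
have [_ k2 k3 _ _] := cornerE okK.1 adjA'.
rewrite oK in k3.
apply: eq_card0 => h; apply/negP => /andP[_ /loop_classP Ph].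
have [|hA _] := Ph h; first exact: connect0.
rewrite inE in hA; have := at_vertex okK.2 adjA (eqP hA).
have na : ~ connect (link (edge K) (corner K a (opp K (edge K c)))) h a.
  move=> ha; have [] := Ph _ (connect_trans ha (link_e _ _ _)).
  by rewrite inE vea eq_sym (negPf nAB).
have nc : ~ connect (link (edge K) (corner K a (opp K (edge K c)))) h (edge K c).
  move=> hc; have [] := Ph _ (connect_trans hc (link_e _ _ _)).
  by rewrite eK inE (negPf nCA).
have jx := link_j (edge K) (corner K a (opp K (edge K c))) h.
rewrite !inE => /or4P[]/eqP eh; rewrite eh in jx na nc.
- by apply: na; apply: connect0.
- by apply: nc; rewrite k3 in jx.
- by apply: nc; apply: connect0.
by apply: na; rewrite k2 in jx.
Qed.

End Corner.

Section UnitR3.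
Variables (G : groupType) (V H : finType) (K : graph_data G V H) (a b c : H).
Hypotheses (okK : graph_ok K) (frag : r3_fragment K a b c).
Local Notation K3 := (r3_result K a b c).
Hypothesis ok3 : graph_ok K3.
Hypothesis a1 : label K (vtx K a) = 1%g.

Let eK := ok_edgeK okK.
Let oK := ok_oppK okK.
Let oV := ok_vtx_opp okK.

Let tri := r3_fragment_triangle frag.
Let labC : label K (vtx K c) = (label K (vtx K b))^-1%g.
Proof.
case/and4P: frag => _ _ _; rewrite a1 mul1g => /eqP bc1.
by rewrite -[RHS]mulg1 -bc1 mulKg.
Qed.
Let tri3 := r3_triangle okK tri.

Let nAB : vtx K a != vtx K b. Proof. by case/andP: tri => /and3P[]. Qed.
Let nBC : vtx K b != vtx K c. Proof. by case/andP: tri => /and3P[]. Qed.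
Let nCA : vtx K c != vtx K a. Proof. by case/andP: tri => /and3P[]. Qed.

Let label3 v : v \in r3_verts K a b c -> label K3 v = (label K v)^-1%g.
Proof. by rewrite !inE /= !inE => ->. Qed.

Let labC3 : label K3 (vtx K3 c) = (label K3 (vtx K3 b))^-1%g.
Proof.
have [_ v2 v3 _] := r3_vtxE okK tri.
by rewrite v2 v3 !label3 ?labC // !inE eqxx ?orbT.
Qed.

Let verts3 : r3_verts K3 a b c = r3_verts K a b c.
Proof. by have [v1 v2 v3 _] := r3_vtxE okK tri; rewrite /r3_verts v1 v2 v3. Qed.

Let nCA' : (vtx K c == vtx K a) = false. Proof. exact: negbTE. Qed.
Let nBA' : (vtx K b == vtx K a) = false. Proof. by rewrite eq_sym; apply: negbTE. Qed.
Let vea : vtx K (edge K a) = vtx K b. Proof. by case/andP: tri => _ /and3P[/and3P[/eqP]]. Qed.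
Let veb : vtx K (edge K b) = vtx K c. Proof. by case/andP: tri => _ /and3P[_ /and3P[/eqP]]. Qed.
Let vec : vtx K (edge K c) = vtx K a. Proof. by case/andP: tri => _ /and3P[_ _ /and3P[/eqP]]. Qed.

(** The six outer half-edges end up joined in the same way on both sides: the
    strand through b becomes a single edge, and on the other two strands the ends
    opp a and opp (edge c), like opp (edge a) and opp c, are joined to each other. *)
Lemma r3_corner_eq h : r3_corner K3 a b c h = r3_corner K a b c h.
Proof.
have [v1 v2 v3 v4] := r3_vtxE okK tri; have [o1 o2 o3 o4] := r3_oppE okK tri.
have := r3_uniq okK tri; rewrite /r3_half_edges /= !inE !negb_or => ?; split_ands.
have -> : r3_corner K3 a b c h = if vtx K3 h == vtx K3 a
  then tperm a (edge K c) (tperm (opp K3 a) (opp K3 (edge K c)) h)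
  else tperm (opp K3 b) (opp K3 (edge K b)) (tperm (opp K3 (edge K a)) (opp K3 c) h) by [].
rewrite v1 !o1 !o2 !o3.
have -> : r3_corner K a b c h = if vtx K h == vtx K a
  then tperm a (edge K c) (tperm (opp K a) (opp K (edge K c)) h)
  else tperm (opp K b) (opp K (edge K b)) (tperm (opp K (edge K a)) (opp K c) h) by [].
have [hL|hL] := boolP (h \in r3_half_edges K a b c).
  move: hL; rewrite !inE; split_ors; move/eqP->;
    rewrite ?v1 ?v2 ?v3 ?oV ?vea ?veb ?vec ?nCA' ?nBA' ?eqxx; by tperm_simp.
have hA : vtx K h == vtx K a = false.
  by move: hL; rewrite -r3_at_vertices // !inE !negb_or => /and3P[/negPf].
rewrite v4 // hA; move: hL; rewrite !inE !negb_or => ?; split_ands.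
by tperm_simp.
Qed.

Lemma bracket_corner_r3 :
  bracket (splice K [set vtx K a] (corner K a (edge K c))) =
  bracket (splice K3 [set vtx K a] (corner K3 a (edge K c))).
Proof.
have [-> ok1 jK jl] := bracket_corner okK tri labC.
have [v1 _ _ v4] := r3_vtxE okK tri; have [_ _ _ o4] := r3_oppE okK tri.
have [e3 _ _ _] := bracket_corner ok3 tri3 labC3.
rewrite v1 in e3; rewrite -[edge K c]/(edge K3 c) e3.
apply: bracket_iso => //; rewrite verts3.
have -> : r3_corner K3 a b c = r3_corner K a b c by apply/funext/r3_corner_eq.
have far h : vtx K h \notin r3_verts K a b c -> h \notin r3_half_edges K a b c.
  by rewrite r3_at_vertices.
have [[_ ne1 _ _ _] _] := ok1.
apply: (@splice_iso _ _ _ _ _ K3 _ _ _ val val) => //.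
- by move=> h; rewrite r3_vtx_verts //; apply: jl.
- exact: ok_vtx_opp ok3.
- exact: val_inj.
- exact: val_inj.
- by move=> w; apply: valP w.
- by move=> v vD; exists (Sub v vD).
- by move=> h; rewrite r3_vtx_verts // => hD; exists (Sub h hD).
- by move=> k; rewrite v4 // far // (valP k).
- move=> k; have kD := valP k.
  rewrite /= val_insubd (exit_live eK jK jl kD); exact: exit_connect.
- by move=> k; rewrite (o4 _ (far _ (valP k))) -(val_opp_splice (r3_corner K a b c) k okK).
- move=> k; have := far _ (valP k); rewrite /= !inE !negb_or => ?; split_ands.
  by eq_simp; rewrite addbF.
- move=> w; have := valP w; rewrite /= !inE !negb_or => ?; split_ands.
  by eq_simp.
congr (_ + _); apply: eq_wire_loops => // h; exact/esym/r3_vtx_verts.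
Qed.

(** After the other smoothing of A, the strand through b crosses the path between
    opp (edge a) and opp (edge c) at B before the move and at C after it, and the
    path between opp a and opp c at C before and at B after it.  Thus B and C are
    exchanged, and a half-edge goes to the one that leads to the same outer ends:
    for instance edge a, which leads through A to opp (edge c), goes to
    opp (edge c).  The values at the half-edges at A only serve to follow paths. *)
Let phi h :=
  if (h == a) || (h == edge K a) then opp K (edge K c)
  else if (h == c) || (h == edge K c) then opp K a
  else if (h == b) || (h == edge K b) then edge K h
  else if h == opp K (edge K a) then c
  else if h == opp K c then edge K a else h.

Let phiE : [/\ (phi a = opp K (edge K c)) * (phi (edge K a) = opp K (edge K c)),
  (phi c = opp K a) * (phi (edge K c) = opp K a),
  (phi b = edge K b) * (phi (edge K b) = b)
  & [/\ phi (opp K (edge K a)) = c, phi (opp K c) = edge K a &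
   forall h, h \notin [:: a; edge K a; b; edge K b; c; edge K c; opp K (edge K a); opp K c] ->
     phi h = h]].
Proof.
have := r3_uniq okK tri; rewrite /r3_half_edges /= !inE !negb_or => ?; split_ands.
split; [| | |split]; try by rewrite /phi; eq_simp; rewrite ?eK.
by move=> h; rewrite !inE !negb_or => ?; split_ands; rewrite /phi; eq_simp.
Qed.

Let out_tri : [/\ (out K a) * (out K b) * (out K c),
  (out K (edge K a) = false) * (out K (edge K b) = false) * (out K (edge K c) = false)
  & forall h, out K (opp K h) = out K h].
Proof.
have [_ [Ke Ks]] := okK; have /and4P[/and3P[oa ob oc] _ _ _] := frag.
rewrite !Ke oa ob oc; split=> // h.
by have := Ks h (opp K h) (esym (oV h)); rewrite eqxx orbT => /eqP.
Qed.

(** [phi] carries links before the move to connected half-edges after it; by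
    [splice_iso] nothing more is needed for the edges to correspond. *)
Lemma noncorner_iso :
  iso (splice K [set vtx K a] (corner K a (opp K (edge K c))))
    (splice K3 [set vtx K a] (corner K3 a (opp K3 (edge K c)))).
Proof.
have adjA : adjacent K a (edge K c).
  by apply: adjacent_sym okK.1; case/andP: tri => _ /and3P[].
have [v1 v2 v3 v4] := r3_vtxE okK tri; have [o1 o2 o3 o4] := r3_oppE okK tri.
have adjA3 : adjacent K3 a (edge K3 c).
  by apply: adjacent_sym ok3.1; case/andP: tri3 => _ /and3P[].
have spl := corner_splicing okK (adjacent_opp adjA okK.1).
have spl3 := corner_splicing ok3 (adjacent_opp adjA3 ok3.1).
rewrite v1 in spl3.
have [jK jl _ _] := spl; have [jK3 jl3 _ _] := spl3.
have [k1 k2 k3 k4 k5] := cornerE okK.1 (adjacent_opp adjA okK.1).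
have [l1 _ _ l4 _] := cornerE ok3.1 (adjacent_opp adjA3 ok3.1).
have [[_ ne1 _ _ _] _] := splicing_ok okK spl.
have [p1 p2 p3 [p4 p5 p6]] := phiE.
have [out1 out2 out3] := out_tri.
pose L := r3_half_edges K a b c.
have notA h : h \notin L -> vtx K h == vtx K a = false.
  by rewrite -r3_at_vertices // !inE !negb_or => /and3P[/negPf].
have live_cases (P : H -> Prop) : P b -> P (edge K a) -> P (opp K b) ->
    P (opp K (edge K a)) -> P c -> P (edge K b) -> P (opp K c) ->
    P (opp K (edge K b)) -> (forall h, h \notin L -> P h) ->
    forall h, vtx K h \notin [set vtx K a] -> P h.
  move=> ? ? ? ? ? ? ? ? Pout h; have [hL|/Pout//] := boolP (h \in L).
  by move: hL; rewrite inE !inE; split_ors; move/eqP->; rewrite ?oV ?vec ?eqxx.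
have live_cases3 (P : H -> Prop) : P b -> P (edge K a) -> P (opp K b) ->
    P (opp K a) -> P c -> P (edge K b) -> P (opp K (edge K c)) ->
    P (opp K (edge K b)) -> (forall h, h \notin L -> P h) ->
    forall h, vtx K3 h \notin [set vtx K a] -> P h.
  move=> ? ? ? ? ? ? ? ? Pout h; have [hL|/Pout//] := boolP (h \in L).
  by move: hL; rewrite in_set1 !inE; split_ors; move/eqP->; rewrite ?v1 ?eqxx.
have p6' h : h \notin L -> phi h = h.
  by move=> hL; apply: p6; apply: contra hL; rewrite !inE; split_ors; move->; rewrite ?orbT.
have oL h : h \notin L -> opp K h \notin L by rewrite -!r3_at_vertices // oV.
have := r3_uniq okK tri; rewrite /r3_half_edges /= !inE !negb_or => ?; split_ands.
have [p7 p8] : phi (opp K b) = opp K b /\ phi (opp K (edge K b)) = opp K (edge K b).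
  by split; apply: p6; rewrite !inE; eq_simp.
have [p9 p10] : phi (opp K a) = opp K a /\ phi (opp K (edge K c)) = opp K (edge K c).
  by split; apply: p6; rewrite !inE; eq_simp.
(* The inverse of phi between the remaining half-edges. *)
pose psi h := if h == opp K (edge K c) then edge K a else if h == opp K a then c
  else if (h == b) || (h == edge K b) then edge K h
  else if h == c then opp K (edge K a) else if h == edge K a then opp K c else h.
have phiK h : vtx K h \notin [set vtx K a] -> psi (phi h) = h.
  move: h; apply: live_cases; rewrite ?p1 ?p2 ?p3 ?p4 ?p5 ?p7 ?p8;
    try by rewrite /psi; eq_simp; rewrite ?eK.
  move=> h hL; rewrite p6' //; move: hL; rewrite !inE !negb_or => ?; split_ands.
  by rewrite /psi; eq_simp.
have psiK h : vtx K3 h \notin [set vtx K a] ->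
    vtx K (psi h) \notin [set vtx K a] /\ phi (psi h) = h.
  move: h; apply: live_cases3.
  1-8: by rewrite in_set1 /psi; eq_simp;
    rewrite ?eK ?p1 ?p2 ?p3 ?p4 ?p5 ?p7 ?p8 ?oV ?vea ?veb ?nCA' ?nBA'.
  move=> h hL; have hA := notA h hL; have ph := p6' h hL.
  move: hL; rewrite !inE !negb_or => ?; split_ands.
  by rewrite /psi; eq_simp; rewrite hA ph.
have tpA v : (tperm (vtx K b) (vtx K c) v == vtx K a) = (v == vtx K a).
  by case: tpermP => [->|->|//]; rewrite nCA' nBA'.
set j3 := corner K3 a (opp K3 (edge K c)).
have {}jK3 : involutive j3 by exact: jK3.
have oK3 : involutive (opp K3) by case: ok3 => -[].
have L1 : j3 a = opp K c by rewrite [LHS]l1 o3.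
have L2 : j3 (edge K c) = opp K (edge K a).
  by rewrite -[edge K c]oK3 [LHS]l4 o1.
have cs3 := link_csym eK jK3.
pose T := [:: a; edge K a; b; edge K b; c; edge K c].
have eT h : (edge K h \in T) = (h \in T).
  by rewrite !inE !(inj_eq (inv_inj eK)) !(inv_eq eK); do 6!case: (h == _).
have link3 h : h \notin T -> connect (link (edge K) j3) (phi h) h.
  move=> hT; have [->|h1] := eqVneq h (opp K (edge K a)).
    by rewrite p4 -L2; apply: connect_trans (link_e _ _ _) (link_j _ _ _).
  have [->|h2] := eqVneq h (opp K c).
    rewrite p5 -L1; apply: connect_trans (link_e _ _ _) _; rewrite eK; exact: link_j.
  by rewrite p6 ?connect0 //; move: hT; rewrite !inE !negb_or => ?; split_ands; eq_simp.
have phi_step x y : connect (link (edge K) (corner K a (opp K (edge K c)))) x y ->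
    connect (link (edge K) j3) (phi x) (phi y).
  move: y; apply: link_ind => [|y xy|y xy]; first exact: connect0.
    apply: connect_trans xy _.
    have [yT|yT] := boolP (y \in T).
      move: yT; rewrite !inE; split_ors; move/eqP->; rewrite ?eK ?p1 ?p2 ?p3 ?connect0 //.
        by have := link_e (edge K) j3 (edge K b); rewrite eK.
      exact: link_e.
    apply: connect_trans (link3 _ yT) (connect_trans (link_e _ _ _) _).
    by rewrite cs3; apply: link3; rewrite eT.
  apply: connect_trans xy _.
  have [->|y1] := eqVneq y a; first by rewrite k1 p1 p10 connect0.
  have [->|y2] := eqVneq y (opp K (edge K c)); first by rewrite k2 p1 p10 connect0.
  rewrite oK in k3 k4.
  have [->|y3] := eqVneq y (opp K a); first by rewrite k3 p2 p9 connect0.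
  have [->|y4] := eqVneq y (edge K c); first by rewrite k4 p2 p9 connect0.
  by rewrite k5 ?connect0 // !inE oK; eq_simp.
have phi_vtx h : vtx K h \notin [set vtx K a] ->
    vtx K3 (phi h) = tperm (vtx K b) (vtx K c) (vtx K h).
  move: h; apply: live_cases;
    rewrite ?p1 ?p2 ?p3 ?p4 ?p5 ?p7 ?p8 ?v1 ?v2 ?v3 ?oV ?vea ?veb ?tpermL ?tpermR //.
  move=> h hL; rewrite p6' // v4 // tpermD // eq_sym;
    by move: hL; rewrite -r3_at_vertices // !inE !negb_or => /and3P[].
have phi_opp h : vtx K h \notin [set vtx K a] -> opp K3 (phi h) = phi (opp K h).
  move: h; apply: live_cases; rewrite ?oK ?p1 ?p2 ?p3 ?p4 ?p5 ?p7 ?p8 ?o1 ?o2 ?o3 //.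
  by move=> h hL; rewrite p6' // o4 // p6' // oL.
have phi_out h : vtx K h \notin [set vtx K a] -> out K3 (phi h) = out K h.
  have out3E x : out K3 x = out K x (+) (x \in T) by rewrite /= !inE.
  rewrite out3E; move: h; apply: live_cases; rewrite ?p1 ?p2 ?p3 ?p4 ?p5 ?p7 ?p8 ?inE;
    eq_simp; rewrite ?out3 ?out1 ?out2 //.
  move=> h hL; rewrite p6' //; move: hL; rewrite !inE !negb_or => ?; split_ands.
  by eq_simp; rewrite addbF.
apply: (@splice_iso _ _ _ _ _ K3 _ [set vtx K a] j3
  (fun w => tperm (vtx K b) (vtx K c) (val w)) (phi \o val)) => //.
- exact: ok_vtx_opp ok3.
- by move=> w w' /perm_inj /val_inj.
- move=> x y /= /(congr1 psi); rewrite (phiK _ (valP x)) (phiK _ (valP y)).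
  exact: val_inj.
- by move=> w; rewrite in_set1 tpA; have := valP w; rewrite in_set1.
- move=> v; rewrite in_set1 -tpA => vA.
  have vA' : tperm (vtx K b) (vtx K c) v \notin [set vtx K a] by rewrite in_set1.
  by exists (exist (fun v => v \notin [set vtx K a]) _ vA'); rewrite /= tpermK.
- move=> h /psiK[hA ph].
  by exists (exist (fun h => vtx K h \notin [set vtx K a]) _ hA).
- by move=> k; apply: phi_vtx (valP k).
- move=> k; have := exit_connect eK jK jl (valP k).
  rewrite -(val_edge_splice k okK spl); exact: phi_step.
- move=> k; rewrite [LHS](phi_opp _ (valP k)).
  by rewrite -(val_opp_splice (corner K a (opp K (edge K c))) k okK).
- by move=> k; apply: phi_out (valP k).
- move=> w; have wA := valP w; rewrite in_set1 in wA.
  have [wB|wB] := eqVneq (val w) (vtx K b).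
    by rewrite wB tpermL label3 ?labC ?invgK -?wB // !inE eqxx !orbT.
  have [wC|wC] := eqVneq (val w) (vtx K c).
    by rewrite wC tpermR label3 -?labC -?wC // !inE eqxx !orbT.
  by rewrite tpermD 1?eq_sym // [LHS]/= !inE; eq_simp.
have z3 := splice_circles_noncorner ok3 tri3; rewrite v1 in z3.
by congr (_ + _); rewrite [RHS]z3; apply: splice_circles_noncorner okK tri.
Qed.

(** Both sides are expanded at A, and the smoothings correspond term by term. *)
Lemma bracket_r3_unit : bracket K = bracket K3.
Proof.
have adjA : adjacent K a (edge K c).
  by apply: adjacent_sym okK.1; case/andP: tri => _ /and3P[].
have adjA3 : adjacent K3 a (edge K3 c).
  by apply: adjacent_sym ok3.1; case/andP: tri3 => _ /and3P[].
have [v1 _ _ _] := r3_vtxE okK tri.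
have a13 : label K3 (vtx K3 a) = 1%g by rewrite v1 label3 ?a1 ?invg1 // !inE eqxx.
have spl := corner_splicing okK (adjacent_opp adjA okK.1).
rewrite (skein okK adjA a1) (skein ok3 adjA3 a13) v1; congr (_ + _)%R.
  exact: bracket_corner_r3.
exact: bracket_iso (splicing_ok okK spl) noncorner_iso.
Qed.

End UnitR3.

Section Invariance.
Variable G : groupType.

Lemma r3_fragment_rot (V H : finType) (K : graph_data G V H) a b c :
  r3_fragment K a b c -> r3_fragment K b c a.
Proof.
case/and4P=> /and3P[u1 u2 u3] /and3P[n1 n2 n3] /and3P[d1 d2 d3] /eqP l1.
apply/and4P; split; try by apply/and3P.
by rewrite -(inj_eq (mulgI (label K (vtx K a)))) !mulgA l1 mul1g mulg1.
Qed.

Lemma r3_result_rot (V H : finType) (K : graph_data G V H) a b c :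
  graph_ok K -> triangle K a b c ->
  r3_result K b c a = r3_result K a b c.
Proof.
move=> okK tri.
have sE : r3_swap K b c a = r3_swap K a b c.
  apply/funext => h.
  have := r3_uniq okK tri; rewrite /r3_half_edges /= !inE !negb_or => ?; split_ands.
  have [hL|hL] := boolP (h \in [:: opp K a; opp K (edge K a); opp K b;
                                   opp K (edge K b); opp K c; opp K (edge K c)]).
    by move: hL; rewrite !inE /r3_swap /=; split_ors; move/eqP->; tperm_simp.
  by move: hL; rewrite !inE !negb_or => ?; split_ands; rewrite /r3_swap /=; tperm_simp.
rewrite /r3_result sE; congr GraphData; apply/funext => x.
  by rewrite -(mem_rot 2 [:: a; edge K a; b; edge K b; c; edge K c]).
by rewrite -(mem_rot 1 [:: vtx K a; vtx K b; vtx K c]).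
Qed.

(** The move is symmetric under rotation of the triangle, so that a unit label can
    be brought to A. *)
Lemma bracket_r3 (V H : finType) (K : graph_data G V H) a b c :
  graph_ok K -> r3_fragment K a b c -> graph_ok (r3_result K a b c) ->
  bracket K = bracket (r3_result K a b c).
Proof.
move=> okK frag ok3; have tri := r3_fragment_triangle frag.
have frag' := r3_fragment_rot frag; have tri' := r3_fragment_triangle frag'.
have frag'' := r3_fragment_rot frag'.
have rot := r3_result_rot okK tri; have rot' := r3_result_rot okK tri'.
have [a1|/eqP a1] := eqVneq (label K (vtx K a)) 1%g; first exact: bracket_r3_unit.
have [b1|/eqP b1] := eqVneq (label K (vtx K b)) 1%g.
  by rewrite -rot; apply: bracket_r3_unit; rewrite ?rot.
have [c1|/eqP c1] := eqVneq (label K (vtx K c)) 1%g.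
  by rewrite -rot -rot'; apply: bracket_r3_unit; rewrite ?rot' ?rot.
exact: bracket_r3_nonunit.
Qed.

Lemma ggraph_ok (K : ggraph G) : graph_ok K.
Proof. by split; [exact: gframed | exact: gsource_sink]. Qed.

Lemma bracket_free_link (K L : ggraph G) :
  free_link_equiv K L -> bracket K = bracket L.
Proof.
elim=> {K L} [K L|//|K L _ ->//|K L M _ -> _ -> //].
have okK := ggraph_ok K; have okL := ggraph_ok L.
case=> [KL|[l [frag KL]]|[l [m [frag KL]]]|[a [b [c [frag KL]]]]].
- exact: bracket_iso.
- by rewrite (bracket_r1 okK frag); apply: bracket_iso (iso_ok (iso_sym KL) okL) KL.
- by rewrite (bracket_r2 okK frag); apply: bracket_iso (iso_ok (iso_sym KL) okL) KL.
have ok3 := iso_ok (iso_sym KL) okL.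
by rewrite (bracket_r3 okK frag ok3); apply: bracket_iso ok3 KL.
Qed.

End Invariance.

Theorem theorem4 (G : groupType) (fpG : finitely_presented G)
    (K K' : ggraph G) (sameKK' : represent_same_knot K K') :
  unit_bracket K = unit_bracket K'.
Proof.
by case: sameKK' => _ _ KK'; rewrite !unit_bracketE; apply: bracket_free_link.
Qed.
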